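(* Consider the distributed online problem and Algorithm 1 described in the context, under Assumptions 1, 2 and 3 stated there. Let $\kappa\in(0,1)$ and $\theta>0$ be constants, let $\tau_t=1/t^{\theta}$, $\Psi_t=\sum_{s=1}^t\tau_s$, and let $\{x_{i,t}\}$ be the sequences generated by Algorithm 1 with $$\alpha_t=\sqrt{\frac{\Psi_t}{t}},\qquad \beta_t=\frac{1}{t^{\kappa}},\qquad \gamma_t=\frac{1}{t^{1-\kappa}},\qquad \forall t\in\mathbb{N}_+ .$$ Then, for any $T\in\mathbb{N}_+$ and any comparator sequence $y_{[T]}=(y_1,\dots,y_T)\in\mathcal{X}_T$, with path-length $P_T=\sum_{t=1}^{T-1}\|y_{t+1}-y_t\|$, $$\mathrm{Net\text{-}Reg}(\{x_{i,t}\},y_{[T]})=\begin{cases}\mathcal{O}\big(T^{\max\{\kappa,1-\theta/2\}}+T^{\theta/2}P_T\big), & \text{if } 0<\theta<1,\\[3pt] \mathcal{O}\Big(T^{\kappa}+\sqrt{T\log(T)}+\sqrt{\frac{T}{\log(T)}}\,P_T\Big), & \text{if } \theta=1,\\[3pt] \mathcal{O}\big(T^{\max\{\kappa,1/2\}}+T^{1/2}P_T\big), & \text{if } \theta>1,\end{cases}$$ $$\mathrm{Net\text{-}CCV}(\{x_{i,t}\})=\begin{cases}\mathcal{O}\big(T^{\max\{1-\kappa/2,\,1-\theta/4\}}\big), & \text{if } 0<\theta<1,\\[3pt] \mathcal{O}\big(T^{1-\kappa/2}+\sqrt[4]{T^3\log(T)}\big), & \text{if } \theta=1,\\[3pt]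 \mathcal{O}\big(T^{\max\{1-\kappa/2,\,3/4\}}\big), & \text{if } \theta>1.\end{cases}$$
   Context: Notation: $[n]=\{1,\dots,n\}$; $\|\cdot\|$ is the Euclidean norm (spectral norm for matrices); $\mathcal{P}_{\mathbb{X}}$ is Euclidean projection onto $\mathbb{X}$; $[\cdot]_+$ is the componentwise positive part; $\mathrm{col}(\cdot)$ is vertical concatenation; vector inequalities are componentwise. Problem. There are $n$ agents, a set $\mathbb{X}\subseteq\mathbb{R}^p$, and for each $i\in[n]$, $t\in\mathbb{N}_+$ a local loss function $f_{i,t}:\mathbb{X}\to\mathbb{R}$ and a local constraint function $g_{i,t}:\mathbb{X}\to\mathbb{R}^{m_i}$; $m=\sum_{i=1}^n m_i$. Put $f_t(x)=\frac1n\sum_{j=1}^n f_{j,t}(x)$ and $g_t(x)=\mathrm{col}(g_{1,t}(x),\dots,g_{n,t}(x))$. For each $T$ let $\mathcal{X}_T=\{(x_1,\dots,x_T): x_t\in\mathbb{X},\ g_t(x_t)\le \mathbf{0}_m\ \forall t\in[T]\}$ and $\hat{\mathcal{X}}_T=\{(x,\dots,x): x\in\mathbb{X},\ g_t(x)\le\mathbf{0}_m\ \forall t\in[T]\}$; both are assumed non-empty. Communication at time $t$ is over a directed graph $\mathcal{G}_t=([n],\mathcal{E}_t)$ with mixing matrix $W_t\in\mathbb{R}^{n\times n}$ satisfying $[W_t]_{ij}>0$ if $(j,i)\in\mathcal{E}_t$ or $i=j$, and $[W_t]_{ij}=0$ otherwise. Assumption 1. (i) $\mathbb{X}$ is convex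 and closed, and $\|x\|\le R(\mathbb{X})$ for all $x\in\mathbb{X}$, for a positive constant $R(\mathbb{X})$. (ii) All $f_{i,t}$ and $g_{i,t}$ (componentwise) are convex, and for some constant $F_1>0$: $|f_{i,t}(x)-f_{i,t}(y)|\le F_1$ and $\|g_{i,t}(x)\|\le F_1$ for all $x,y\in\mathbb{X}$, $i$, $t$. (iii) Subgradients $\partial f_{i,t}(x)\in\mathbb{R}^p$ and $\partial g_{i,t}(x)\in\mathbb{R}^{p\times m_i}$ (whose $k$-th column is a subgradient of the $k$-th component of $g_{i,t}$) exist at every $x\in\mathbb{X}$, and for some constant $F_2>0$: $\|\partial f_{i,t}(x)\|\le F_2$, $\|\partial g_{i,t}(x)\|\le F_2$ for all $x\in\mathbb{X}$, $i$, $t$. Here $\partial[g_{i,t}(x)]_+\in\mathbb{R}^{p\times m_i}$ denotes a subgradient of $x\mapsto[g_{i,t}(x)]_+$: its $k$-th column is $s_k$ times the $k$-th column of $\partial g_{i,t}(x)$, with $s_k=1$ if the $k$-th component of $g_{i,t}(x)$ is positive, $s_k=0$ if it is negative, and $s_k\in[0,1]$ if it is zero. Assumption 2. (i) There is $w\in(0,1)$ with $[W_t]_{ij}\ge w$ whenever $[W_t]_{ij}>0$. (ii) Each $W_t$ is doubly stochastic. (iii) There is an integer $B>0$ such that for all $t\in\mathbb{N}_+$ the graph $([n],\bigcup_{l=0}^{B-1}\mathcal{E}_{t+l})$ is strongly connected. Assumption 3. The threshold sequence $\{\tau_t\}$ is non-increasing. Algorithm 1 (with positive parameter sequences $\{\alpha_t\},\{\beta_t\},\{\gamma_t\},\{\tau_t\}$).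 Initialize $x_{i,1}\in\mathbb{X}$ arbitrarily, $\hat x_{i,1}=x_{i,1}$, $q_{i,1}=\mathbf{0}_{m_i}$. For $t=1,2,\dots$ and each $i\in[n]$: $z_{i,t+1}=\sum_{j=1}^n[W_t]_{ij}\hat x_{j,t}$; $\omega_{i,t+1}=\partial f_{i,t}(x_{i,t})+\partial[g_{i,t}(x_{i,t})]_+\,q_{i,t}$; $x_{i,t+1}=\mathcal{P}_{\mathbb{X}}(z_{i,t+1}-\alpha_{t+1}\omega_{i,t+1})$; $q_{i,t+1}=\big[(1-\beta_{t+1}\gamma_{t+1})q_{i,t}+\gamma_{t+1}\big([g_{i,t}(x_{i,t})]_+ +(\partial[g_{i,t}(x_{i,t})]_+)^T(x_{i,t+1}-x_{i,t})\big)\big]_+$; if $\|x_{i,t+1}-\hat x_{i,t}\|\ge\tau_{t+1}$ set $\hat x_{i,t+1}=x_{i,t+1}$, else set $\hat x_{i,t+1}=\hat x_{i,t}$. Performance metrics: $\mathrm{Net\text{-}Reg}(\{x_{i,t}\},y_{[T]})=\frac1n\sum_{i=1}^n\sum_{t=1}^T f_t(x_{i,t})-\sum_{t=1}^T f_t(y_t)$ and $\mathrm{Net\text{-}CCV}(\{x_{i,t}\})=\frac1n\sum_{i=1}^n\sum_{t=1}^T\|[g_t(x_{i,t})]_+\|$. Convention: $A=\mathcal{O}(B)$ means $A\le C\,B$ for all sufficiently large $T$, where the constant $C>0$ (and the threshold on $T$) does not depend on $T$ or on the comparator sequence, but may depend on the fixed problem data and algorithm parameters. *)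

(* Defs.v *)
From HB Require Import structures.
From mathcomp Require Import all_boot all_order all_algebra.
From mathcomp Require Import all_classical all_reals all_analysis.

Set Implicit Arguments.
Unset Strict Implicit.
Unset Printing Implicit Defensive.

Import Order.TTheory GRing.Theory Num.Theory.
Import numFieldNormedType.Exports.

Local Open Scope classical_set_scope.
Local Open Scope ring_scope.

(* The library norm on matrices is the max-norm, so the Euclidean norm and the
   operator norm it induces are defined here. *)
Definition enorm (R : realType) (d : nat) (v : 'cV[R]_d) : R :=
  Num.sqrt (\sum_(k < d) v k 0 ^+ 2).

Definition spectral_norm (R : realType) (a b : nat) (A : 'M[R]_(a, b)) : R :=
  sup [set enorm (A *m v) | v in [set v : 'cV[R]_b | enorm v <= 1]].

Definition inner (R : realType) (d : nat) (u v : 'cV[R]_d) : R :=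
  \sum_(k < d) u k 0 * v k 0.

Definition pos_part (R : realType) (d : nat) (v : 'cV[R]_d) : 'cV[R]_d :=
  map_mx (fun r => Num.max r 0) v.

Definition vec_le (R : realType) (d : nat) (u v : 'cV[R]_d) : Prop :=
  forall k, u k 0 <= v k 0.

(* [y] is the Euclidean projection of [z] onto [X]; it exists and is unique
   when [X] is closed, convex and nonempty. *)
Definition is_projection (R : realType) (p : nat) (X : set 'cV[R]_p)
    (z y : 'cV[R]_p) : Prop :=
  X y /\ forall u, X u -> enorm (z - y) <= enorm (z - u).

(* The losses and constraints live on [X] only, hence subgradients relative
   to [X]. *)
Definition is_subgradient (R : realType) (p : nat) (X : set 'cV[R]_p)
    (h : 'cV[R]_p -> R) (x s : 'cV[R]_p) : Prop :=
  forall y, X y -> h x + inner s (y - x) <= h y.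

(* [D'] is obtained from [D], whose columns are subgradients of the components
   of a constraint function with value [v], by the chain rule for [_]_+. *)
Definition is_pos_part_subgradient (R : realType) (p d : nat)
    (v : 'cV[R]_d) (D D' : 'M[R]_(p, d)) : Prop :=
  exists s : 'I_d -> R,
    forall k,
      [/\ 0 < v k 0 -> s k = 1,
          v k 0 < 0 -> s k = 0,
          v k 0 = 0 -> 0 <= s k <= 1
        & col k D' = s k *: col k D].

(* Throughout, time indices are natural numbers of which only t >= 1 matter. *)

Definition global_loss (R : realType) (n p : nat)
    (f : 'I_n -> nat -> 'cV[R]_p -> R) (t : nat) (x : 'cV[R]_p) : R :=
  n%:R^-1 * \sum_(j < n) f j t x.

Definition global_constraint (R : realType) (n p : nat) (m : 'I_n -> nat)
    (g : forall i : 'I_n, nat -> 'cV[R]_p -> 'cV[R]_(m i))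
    (t : nat) (x : 'cV[R]_p) : 'cV[R]_(\sum_i m i) :=
  \mxcol_i g i t x.

Definition feasible_seq (R : realType) (n p : nat) (m : 'I_n -> nat)
    (X : set 'cV[R]_p)
    (g : forall i : 'I_n, nat -> 'cV[R]_p -> 'cV[R]_(m i)) (T : nat)
    (y : nat -> 'cV[R]_p) : Prop :=
  forall t, (1 <= t <= T)%N -> X (y t) /\ vec_le (global_constraint g t (y t)) 0.

Definition feasible_static (R : realType) (n p : nat) (m : 'I_n -> nat)
    (X : set 'cV[R]_p)
    (g : forall i : 'I_n, nat -> 'cV[R]_p -> 'cV[R]_(m i)) (T : nat)
    (y : 'cV[R]_p) : Prop :=
  X y /\ forall t, (1 <= t <= T)%N -> vec_le (global_constraint g t y) 0.

(* [E t j i] stands for (j, i) being an edge at time [t]. *)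
Definition mixing_of_graph (R : realType) (n : nat)
    (E : nat -> rel 'I_n) (W : nat -> 'M[R]_n) : Prop :=
  forall t, (0 < t)%N -> forall i j,
    (E t j i \/ i = j -> 0 < W t i j) /\ (~ (E t j i \/ i = j) -> W t i j = 0).

Definition doubly_stochastic (R : realType) (n : nat) (A : 'M[R]_n) : Prop :=
  [/\ forall i j, 0 <= A i j,
      forall i, \sum_(j < n) A i j = 1
    & forall j, \sum_(i < n) A i j = 1].

Record Assumption1 (R : realType) (n p : nat) (m : 'I_n -> nat)
    (X : set 'cV[R]_p)
    (f : 'I_n -> nat -> 'cV[R]_p -> R)
    (g : forall i : 'I_n, nat -> 'cV[R]_p -> 'cV[R]_(m i))
    (df : 'I_n -> nat -> 'cV[R]_p -> 'cV[R]_p)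
    (dg : forall i : 'I_n, nat -> 'cV[R]_p -> 'M[R]_(p, m i))
    (RX F1 F2 : R) : Prop := {
  A1_convex : @convex_set R 'cV[R]_p X;
  A1_closed : closed X;
  A1_RX : 0 < RX;
  A1_bounded : forall x, X x -> enorm x <= RX;
  A1_f_convex : forall i t, (0 < t)%N ->
    @convex_function R 'cV[R]_p X (f i t);
  A1_g_convex : forall i t, (0 < t)%N -> forall k,
    @convex_function R 'cV[R]_p X (fun x => g i t x k 0);
  A1_F1 : 0 < F1;
  A1_f_bound : forall i t, (0 < t)%N -> forall x y, X x -> X y ->
    `|f i t x - f i t y| <= F1;
  A1_g_bound : forall i t, (0 < t)%N -> forall x, X x -> enorm (g i t x) <= F1;
  A1_df : forall i t, (0 < t)%N -> forall x, X x ->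
    is_subgradient X (f i t) x (df i t x);
  A1_dg : forall i t, (0 < t)%N -> forall x, X x -> forall k,
    is_subgradient X (fun y => g i t y k 0) x (col k (dg i t x));
  A1_F2 : 0 < F2;
  A1_df_bound : forall i t, (0 < t)%N -> forall x, X x ->
    enorm (df i t x) <= F2;
  A1_dg_bound : forall i t, (0 < t)%N -> forall x, X x ->
    spectral_norm (dg i t x) <= F2
}.

Record Assumption2 (R : realType) (n : nat)
    (E : nat -> rel 'I_n) (W : nat -> 'M[R]_n) (w : R) (B : nat) : Prop := {
  A2_w : 0 < w < 1;
  A2_lower : forall t, (0 < t)%N -> forall i j, 0 < W t i j -> w <= W t i j;
  A2_stochastic : forall t, (0 < t)%N -> doubly_stochastic (W t);
  A2_B : (0 < B)%N;
  A2_connected : forall t, (0 < t)%N -> forall i j,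
    connect (fun a b => [exists l : 'I_B, E (t + l)%N a b]) i j
}.

Definition Assumption3 (R : realType) (tau : nat -> R) : Prop :=
  forall s t, (0 < s <= t)%N -> tau t <= tau s.

(* [df] and [dgp] are the subgradients of the losses and of the positive parts
   of the constraints that the algorithm uses. *)
Record Algorithm1 (R : realType) (n p : nat) (m : 'I_n -> nat)
    (X : set 'cV[R]_p)
    (g : forall i : 'I_n, nat -> 'cV[R]_p -> 'cV[R]_(m i))
    (df : 'I_n -> nat -> 'cV[R]_p -> 'cV[R]_p)
    (dgp : forall i : 'I_n, nat -> 'cV[R]_p -> 'M[R]_(p, m i))
    (W : nat -> 'M[R]_n)
    (alpha beta gamma tau : nat -> R)
    (x xhat z omega : 'I_n -> nat -> 'cV[R]_p)
    (q : forall i : 'I_n, nat -> 'cV[R]_(m i)) : Prop := {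
  alg_x1 : forall i, X (x i 1%N);
  alg_xhat1 : forall i, xhat i 1%N = x i 1%N;
  alg_q1 : forall i, q i 1%N = 0;
  alg_z : forall i t, (0 < t)%N ->
    z i t.+1 = \sum_(j < n) W t i j *: xhat j t;
  alg_omega : forall i t, (0 < t)%N ->
    omega i t.+1 = df i t (x i t) + dgp i t (x i t) *m q i t;
  alg_x : forall i t, (0 < t)%N ->
    is_projection X (z i t.+1 - alpha t.+1 *: omega i t.+1) (x i t.+1);
  alg_q : forall i t, (0 < t)%N ->
    q i t.+1 = pos_part
      ((1 - beta t.+1 * gamma t.+1) *: q i t
       + gamma t.+1 *: (pos_part (g i t (x i t))
                        + (dgp i t (x i t))^T *m (x i t.+1 - x i t)));
  alg_xhat : forall i t, (0 < t)%N ->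
    xhat i t.+1 =
      if tau t.+1 <= enorm (x i t.+1 - xhat i t) then x i t.+1 else xhat i t
}.

Definition net_reg (R : realType) (n p : nat)
    (f : 'I_n -> nat -> 'cV[R]_p -> R)
    (x : 'I_n -> nat -> 'cV[R]_p) (y : nat -> 'cV[R]_p) (T : nat) : R :=
  n%:R^-1 * (\sum_(i < n) \sum_(1 <= t < T.+1) global_loss f t (x i t))
  - \sum_(1 <= t < T.+1) global_loss f t (y t).

Definition net_ccv (R : realType) (n p : nat) (m : 'I_n -> nat)
    (g : forall i : 'I_n, nat -> 'cV[R]_p -> 'cV[R]_(m i))
    (x : 'I_n -> nat -> 'cV[R]_p) (T : nat) : R :=
  n%:R^-1 * (\sum_(i < n) \sum_(1 <= t < T.+1)
               enorm (pos_part (global_constraint g t (x i t)))).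

Definition path_length (R : realType) (p : nat) (y : nat -> 'cV[R]_p)
    (T : nat) : R :=
  \sum_(1 <= t < T) enorm (y t.+1 - y t).

Definition reg_rate (R : realType) (theta kappa : R) (T : nat) (P : R) : R :=
  if theta < 1 then
    T%:R `^ Num.max kappa (1 - theta / 2) + T%:R `^ (theta / 2) * P
  else if theta == 1 then
    T%:R `^ kappa + Num.sqrt (T%:R * ln T%:R) + Num.sqrt (T%:R / ln T%:R) * P
  else
    T%:R `^ Num.max kappa (1 / 2) + T%:R `^ (1 / 2) * P.

Definition ccv_rate (R : realType) (theta kappa : R) (T : nat) : R :=
  if theta < 1 then
    T%:R `^ Num.max (1 - kappa / 2) (1 - theta / 4)
  else if theta == 1 then
    T%:R `^ (1 - kappa / 2) + (T%:R ^+ 3 * ln T%:R) `^ (1 / 4)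
  else
    T%:R `^ Num.max (1 - kappa / 2) (3 / 4).

(* Main.v *)
(* Let [Psi_T] be the sum of the first [T] thresholds, so that
   [alpha_t = sqrt (Psi_t / t)], and let [Q_T = sqrt (T * Psi_T)].  Up to
   constants, the sums of [alpha_t], of [tau_t / alpha_(t+1)] and of [tau_t] are
   at most [Q_T], and [1 / alpha_(T+1)] is at most [sqrt (T / Psi_T)].

   In each round the term [<q_t, b_t>], with [b_t] the linearised constraint at
   [x_(t+1)], enters the primal descent inequality and the drift inequality of
   [|q_t|^2] with opposite signs.  It cancels when the two are added, so the
   growth of the multipliers never multiplies [alpha_t].  What remains on the
   right-hand side are terms linear in [|x_(t+1) - z_(t+1)|] and in the
   disagreement of the broadcast iterates; the disagreement is summed by
   Doeblin's contraction of the products of the mixing matrices, which again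
   gives terms linear in [|x_(t+1) - z_(t+1)|], and these are absorbed by
   [|x_(t+1) - z_(t+1)|^2 / alpha_(t+1)].  Abel summation gives the regret bound
   [T^kappa + Q_T + sqrt (T / Psi_T) * P_T].

   With a static comparator the same inequality bounds by a multiple of [T] the
   sums of [beta_(t+1) |q_t|^2] and of [|x_(t+1) - z_(t+1)|^2 / alpha_(t+1)], as
   well as [|q_(T+1)|^2 / gamma_(T+1)].  The multiplier update bounds the sum of
   the [b_t] by [q_(T+1) / gamma_(T+1)] plus the sum of [beta_(t+1) q_t], and
   AM-GM with weights [T^(- kappa / 2)] and [sqrt (Q_T / T)] turns this into
   [T^(1 - kappa / 2) + sqrt (T * Q_T)]. *)
Require Import Defs.
From HB Require Import structures.
From mathcomp Require Import all_boot all_order all_algebra.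
From mathcomp Require Import all_classical all_reals all_analysis.
From mathcomp Require Import ring lra.

Set Implicit Arguments.
Unset Strict Implicit.
Unset Printing Implicit Defensive.

Import Order.TTheory GRing.Theory Num.Theory.
Import numFieldNormedType.Exports.

Local Open Scope classical_set_scope.
Local Open Scope ring_scope.

(** * Euclidean geometry *)

Section Euclidean.
Context {R : realType}.
Implicit Types d : nat.

Lemma innerC d (u v : 'cV[R]_d) : inner u v = inner v u.
Proof. by apply: eq_bigr => k _; rewrite mulrC. Qed.

Lemma innerDl d (u v w : 'cV[R]_d) : inner (u + v) w = inner u w + inner v w.
Proof. by rewrite -big_split; apply: eq_bigr => k _; rewrite mxE mulrDl. Qed.

Lemma innerZl d a (u v : 'cV[R]_d) : inner (a *: u) v = a * inner u v.
Proof. by rewrite mulr_sumr; apply: eq_bigr => k _; rewrite mxE mulrA. Qed.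

Lemma innerNl d (u v : 'cV[R]_d) : inner (- u) v = - inner u v.
Proof. by rewrite -scaleN1r innerZl mulN1r. Qed.

Lemma innerBl d (u v w : 'cV[R]_d) : inner (u - v) w = inner u w - inner v w.
Proof. by rewrite innerDl innerNl. Qed.

Lemma innerDr d (u v w : 'cV[R]_d) : inner w (u + v) = inner w u + inner w v.
Proof. by rewrite innerC innerDl !(innerC w). Qed.

Lemma innerZr d a (u v : 'cV[R]_d) : inner u (a *: v) = a * inner u v.
Proof. by rewrite innerC innerZl innerC. Qed.

Lemma innerNr d (u v : 'cV[R]_d) : inner u (- v) = - inner u v.
Proof. by rewrite innerC innerNl innerC. Qed.

Lemma innerBr d (u v w : 'cV[R]_d) : inner w (u - v) = inner w u - inner w v.
Proof. by rewrite innerDr innerNr. Qed.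

Lemma inner_mulmx a b (A : 'M[R]_(a, b)) (u : 'cV[R]_b) (v : 'cV[R]_a) :
  inner (A *m u) v = inner u (A^T *m v).
Proof.
transitivity (\sum_(i < a) \sum_(j < b) A i j * u j 0 * v i 0).
  by apply: eq_bigr => i _; rewrite mxE mulr_suml.
rewrite exchange_big; apply: eq_bigr => j _; rewrite mxE mulr_sumr.
by apply: eq_bigr => i _; rewrite !mxE; ring.
Qed.

Lemma inner_ge0 d (v : 'cV[R]_d) : 0 <= inner v v.
Proof. by apply: sumr_ge0 => k _; rewrite -expr2 sqr_ge0. Qed.

Lemma enorm_ge0 d (v : 'cV[R]_d) : 0 <= enorm v.
Proof. exact: sqrtr_ge0. Qed.

Lemma enormE d (v : 'cV[R]_d) : enorm v ^+ 2 = inner v v.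
Proof.
rewrite sqr_sqrtr; last by apply: sumr_ge0 => k _; rewrite sqr_ge0.
by apply: eq_bigr => k _; rewrite expr2.
Qed.

Lemma enorm_le d (u : 'cV[R]_d) c : 0 <= c -> inner u u <= c ^+ 2 -> enorm u <= c.
Proof. by move=> c0 h; rewrite -ler_sqr ?nnegrE ?enorm_ge0// enormE. Qed.

Lemma enorm0 d : enorm (0 : 'cV[R]_d) = 0.
Proof.
by rewrite /enorm big1 ?sqrtr0// => k _; rewrite mxE expr0n.
Qed.

Lemma enormN d (v : 'cV[R]_d) : enorm (- v) = enorm v.
Proof. by congr Num.sqrt; apply: eq_bigr => k _; rewrite mxE sqrrN. Qed.

Lemma enormBC d (u v : 'cV[R]_d) : enorm (u - v) = enorm (v - u).
Proof. by rewrite -enormN opprB. Qed.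

Lemma enormZ d a (v : 'cV[R]_d) : enorm (a *: v) = `|a| * enorm v.
Proof.
apply/eqP; rewrite -(@eqrXn2 _ 2) ?mulr_ge0 ?enorm_ge0//.
by rewrite exprMn !enormE innerZl innerZr mulrA -expr2 -normrX ger0_norm ?sqr_ge0.
Qed.

Lemma enorm_eq0 d (v : 'cV[R]_d) : enorm v = 0 -> v = 0.
Proof.
move=> v0; apply/colP => k; rewrite mxE.
have /eqP : \sum_(k < d) v k 0 * v k 0 = 0 by rewrite -[LHS]enormE v0 expr0n.
rewrite psumr_eq0; last by move=> i _; rewrite -expr2 sqr_ge0.
by move=> /allP/(_ k (mem_index_enum _)); rewrite mulf_eq0 orbb => /eqP.
Qed.

(** The squared norm of [enorm v *: u - enorm u *: v] expands to [2 * (enorm u * enorm v)] times the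
    gap of the inequality; zero vectors are treated apart so that this factor can be divided out. *)
Lemma cauchy_schwarz d (u v : 'cV[R]_d) : inner u v <= enorm u * enorm v.
Proof.
have [/enorm_eq0 -> |a0] := eqVneq (enorm u) 0.
  by rewrite enorm0 mul0r -(scale0r 0) innerZl mul0r.
have [/enorm_eq0 -> |b0] := eqVneq (enorm v) 0.
  by rewrite enorm0 mulr0 -(scale0r 0) innerZr mul0r.
have ab0 : 0 < 2 * (enorm u * enorm v).
  by rewrite !mulr_gt0// lt0r ?a0 ?b0 enorm_ge0.
rewrite -subr_ge0 -(pmulr_rge0 _ ab0).
have := inner_ge0 (enorm v *: u - enorm u *: v).
by rewrite !(innerBl, innerBr, innerZl, innerZr) (innerC v u) -!enormE; lra.
Qed.

Lemma ler_enormD d (u v : 'cV[R]_d) : enorm (u + v) <= enorm u + enorm v.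
Proof.
apply: enorm_le; first by rewrite addr_ge0 ?enorm_ge0.
rewrite !(innerDl, innerDr) sqrrD -!enormE (innerC v u) -mulr_natr.
by have := cauchy_schwarz u v; lra.
Qed.

Lemma ler_enormB d (u v : 'cV[R]_d) : enorm (u - v) <= enorm u + enorm v.
Proof. by rewrite -(enormN v) ler_enormD. Qed.

Lemma ler_enorm_dist d (v u w : 'cV[R]_d) :
  enorm (u - w) <= enorm (u - v) + enorm (v - w).
Proof. by rewrite -[u - w](subrKA v) ler_enormD. Qed.

Lemma ler_enorm_sum d (I : Type) (r : seq I) (P : pred I) (F : I -> 'cV[R]_d) :
  enorm (\sum_(i <- r | P i) F i) <= \sum_(i <- r | P i) enorm (F i).
Proof.
elim/big_ind2: _ => [|x a y b ha hb|//]; first by rewrite enorm0.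
by rewrite (le_trans (ler_enormD _ _))// lerD.
Qed.

Lemma ler_coord_enorm d (v : 'cV[R]_d) k : `|v k 0| <= enorm v.
Proof.
rewrite -ler_sqr ?nnegrE ?enorm_ge0// enormE /inner (bigD1 k)//= -normrX.
rewrite ger0_norm ?sqr_ge0// expr2 lerDl sumr_ge0// => i _.
by rewrite -expr2 sqr_ge0.
Qed.

Lemma enorm_le_coord d (u v : 'cV[R]_d) :
  (forall k, `|u k 0| <= `|v k 0|) -> enorm u <= enorm v.
Proof.
move=> h; apply: enorm_le; first exact: enorm_ge0.
rewrite enormE; apply: ler_sum => k _.
rewrite -!expr2 -(real_normK (num_real _)) -[leRHS](real_normK (num_real _)).
by rewrite ler_sqr ?nnegrE.
Qed.

End Euclidean.

(** * Operator norms, positive parts and projections *)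

Section Matrices.
Context {R : realType}.

(** A crude bound that shows the set inside [spectral_norm] to be bounded above, so that its [sup]
    is a genuine supremum. *)
Lemma enorm_mulmx_bounded a b (A : 'M[R]_(a, b)) (v : 'cV[R]_b) :
  enorm (A *m v) <= (\sum_j enorm (col j A)) * enorm v.
Proof.
have -> : A *m v = \sum_j v j 0 *: col j A.
  apply/colP => i; rewrite mxE summxE; apply: eq_bigr => j _.
  by rewrite !mxE mulrC.
rewrite mulr_suml (le_trans (ler_enorm_sum _ _ _))//.
apply: ler_sum => j _; rewrite enormZ mulrC.
by rewrite ler_wpM2l ?enorm_ge0 ?ler_coord_enorm.
Qed.

Lemma enorm_mulmx_spectral a b (A : 'M[R]_(a, b)) (v : 'cV[R]_b) :
  enorm (A *m v) <= spectral_norm A * enorm v.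
Proof.
have [/enorm_eq0 ->|v0] := eqVneq (enorm v) 0.
  by rewrite mulmx0 !enorm0 mulr0.
have vgt0 : 0 < enorm v by rewrite lt0r v0 enorm_ge0.
rewrite -ler_pdivrMr// mulrC -[X in X * _]ger0_norm ?invr_ge0 ?enorm_ge0//.
rewrite -enormZ scalemxAr; apply: ub_le_sup; last first.
  by exists ((enorm v)^-1 *: v) => //=; rewrite enormZ ger0_norm ?invr_ge0 ?enorm_ge0// mulVf.
exists (\sum_j enorm (col j A)) => _ [u /= u1 <-].
rewrite (le_trans (enorm_mulmx_bounded _ _))// ler_piMr//.
by apply: sumr_ge0 => j _; exact: enorm_ge0.
Qed.

(** The square of the norm of [A^T *m u] is the inner product of [A *m (A^T *m u)] with [u];
    Cauchy-Schwarz and a division finish. *)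
Lemma enorm_tr_mulmx a b (A : 'M[R]_(a, b)) c : 0 <= c ->
  (forall v, enorm (A *m v) <= c * enorm v) ->
  forall u, enorm (A^T *m u) <= c * enorm u.
Proof.
move=> c0 Ac u; have [->|n0] := eqVneq (enorm (A^T *m u)) 0.
  by rewrite mulr_ge0 ?enorm_ge0.
have gt0 : 0 < enorm (A^T *m u) by rewrite lt0r n0 enorm_ge0.
rewrite -(ler_pM2l gt0) -expr2 enormE -inner_mulmx.
rewrite (le_trans (cauchy_schwarz _ _))// mulrA (mulrC _ c).
by rewrite ler_wpM2r ?enorm_ge0.
Qed.

Lemma pos_part_ge0 d (v : 'cV[R]_d) k : 0 <= pos_part v k 0.
Proof. by rewrite mxE le_max lexx orbT. Qed.

Lemma ler_pos_part d (v : 'cV[R]_d) k : v k 0 <= pos_part v k 0.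
Proof. by rewrite mxE le_max lexx. Qed.

Lemma enorm_pos_part d (v : 'cV[R]_d) : enorm (pos_part v) <= enorm v.
Proof.
apply: enorm_le_coord => k; rewrite mxE.
by case: (lerP (v k 0) 0) => h; rewrite ?normr0.
Qed.

Lemma pos_part_subgradientE (p d : nat) (v : 'cV[R]_d) (D D' : 'M[R]_(p, d)) :
  is_pos_part_subgradient v D D' ->
  exists s : 'I_d -> R, [/\ forall k, 0 <= s k <= 1,
    forall k, 0 < v k 0 -> s k = 1, forall k, v k 0 < 0 -> s k = 0
    & forall k, col k D' = s k *: col k D].
Proof.
move=> [s sP]; exists s; split=> k; have [s1 s0 s01 E] := sP k => //.
by have [h|h|h] := ltrgt0P (v k 0); [rewrite s1//|rewrite s0//|exact: s01];
  rewrite lexx ler01.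
Qed.

(** [D'] is [D] times a diagonal matrix with entries in [0,1], and such a diagonal matrix shrinks
    [u]. *)
Lemma enorm_pos_part_subgradient (p d : nat) (v : 'cV[R]_d)
    (D D' : 'M[R]_(p, d)) c (u : 'cV[R]_d) :
  is_pos_part_subgradient v D D' -> spectral_norm D <= c -> 0 <= c ->
  enorm (D' *m u) <= c * enorm u.
Proof.
move=> /pos_part_subgradientE[s [s01 _ _ sE]] Dc c0.
have -> : D' *m u = D *m (\col_k (s k * u k 0)).
  apply/colP => i; rewrite !mxE; apply: eq_bigr => j _; rewrite !mxE.
  by have /colP/(_ i) := sE j; rewrite !mxE => ->; ring.
apply: (le_trans (enorm_mulmx_spectral _ _)).
apply: (le_trans (ler_wpM2r (enorm_ge0 _) Dc)).
rewrite ler_wpM2l//; apply: enorm_le_coord => k; rewrite mxE normrM ler_piMl//.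
by have /andP[? ?] := s01 k; rewrite ger0_norm.
Qed.

Lemma tr_mulmx_inner a b (A : 'M[R]_(a, b)) (u : 'cV[R]_a) k :
  (A^T *m u) k 0 = inner (col k A) u.
Proof. by rewrite mxE; apply: eq_bigr => i _; rewrite !mxE. Qed.

(** The weight [s k] is a subgradient of the positive part at [h x k 0], so its product with a
    subgradient of the component obeys the chain rule. At the kink, [s k] in [0,1] scales the
    subgradient inequality of [h]. *)
Lemma pos_part_subgradientP (p d : nat) (X : set 'cV[R]_p)
    (h : 'cV[R]_p -> 'cV[R]_d) (D D' : 'M[R]_(p, d)) x y :
  (forall k, is_subgradient X (fun z => h z k 0) x (col k D)) ->
  is_pos_part_subgradient (h x) D D' -> X y ->
  forall k, pos_part (h x) k 0 + (D'^T *m (y - x)) k 0 <= pos_part (h y) k 0.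
Proof.
move=> hD /pos_part_subgradientE[s [s01 s1 s0 sE]] Xy k.
rewrite tr_mulmx_inner sE innerZl [in leLHS]mxE.
have := hD k y Xy; have := ler_pos_part (h y) k; have := pos_part_ge0 (h y) k.
have /andP[sk0 sk1] := s01 k.
case: (ltrgtP (h x k 0) 0) => [/s0 ->|/s1 ->|e0]; [lra|lra|].
by rewrite e0; nra.
Qed.

(** If the inner product [s] were positive, moving from [y] towards [u] inside the convex set would
    come strictly closer to [z]: a fraction [l] changes the squared distance by
    [- 2 * l * s + l ^+ 2 * N]. *)
Lemma projection_obtuse (p : nat) (X : set 'cV[R]_p) (z y u : 'cV[R]_p) :
  @convex_set R 'cV[R]_p X -> is_projection X z y -> X u ->
  inner (z - y) (u - y) <= 0.
Proof.
move=> cX [Xy yP] Xu; rewrite leNgt; apply/negP => s_gt0.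
set s := inner _ _ in s_gt0; set N := inner (u - y) (u - y).
have N0 : 0 <= N by exact: inner_ge0.
(* Any positive [l] at most 1 with [l * N < 2 * s] would do; having [s] in the denominator gives
   [l <= 1] and avoids a division by zero. *)
pose l := s / (s + N).
have l0 : 0 < l by rewrite divr_gt0//; lra.
have l1 : l <= 1 by rewrite ler_pdivrMr; lra.
have lN : l * N <= s.
  by rewrite mulrAC ler_pdivrMr; [nra|lra].
have Xl : X (y + l *: (u - y)).
  have -> : y + l *: (u - y) = l *: u + (1 - l) *: y.
    by rewrite scalerBr scalerBl scale1r addrCA.
  have := cX u y (Itv01 (ltW l0) l1).
  by rewrite !inE => /(_ Xu Xy).
have := yP _ Xl; rewrite -ler_sqr ?nnegrE ?enorm_ge0// !enormE.
have -> : z - (y + l *: (u - y)) = (z - y) - l *: (u - y).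
  by rewrite opprD addrA.
have sqE (a b : 'cV[R]_p) : inner (a - l *: b) (a - l *: b) =
    inner a a - 2 * l * inner a b + l ^+ 2 * inner b b.
  by rewrite !(innerBl, innerBr, innerZl, innerZr) (innerC b a); ring.
by rewrite sqE -/N -/s; nra.
Qed.

(** The obtuse-angle inequality at [z - a *: om], with the inner product of [z - x] and [x - y]
    rewritten by the three-point identity. *)
Lemma projection_step (p : nat) (X : set 'cV[R]_p) (z om x y : 'cV[R]_p) a :
  @convex_set R 'cV[R]_p X -> is_projection X (z - a *: om) x -> X y -> 0 < a ->
  inner om (x - y) <=
  (2 * a)^-1 * (enorm (z - y) ^+ 2 - enorm (x - y) ^+ 2 - enorm (x - z) ^+ 2).
Proof.
move=> cX prx Xy a0; have := projection_obtuse cX prx Xy.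
rewrite ler_pdivlMl ?mulr_gt0// !enormE.
rewrite !(innerBl, innerBr, innerZl, innerZr).
rewrite (innerC y z) (innerC x z) (innerC y x).
by lra.
Qed.

(** Squared norms add over the blocks, and a sum of squares of nonnegative numbers is at most the
    square of their sum. *)
Lemma enorm_mxcol_pos_part (n : nat) (m : 'I_n -> nat)
    (v : forall i, 'cV[R]_(m i)) :
  enorm (pos_part (\mxcol_i v i)) <= \sum_i enorm (pos_part (v i)).
Proof.
have -> : pos_part (\mxcol_i v i) = \mxcol_i pos_part (v i).
  by apply/matrixP => i j; rewrite !mxE.
have S0 : 0 <= \sum_i enorm (pos_part (v i)) by apply: sumr_ge0 => i _; exact: enorm_ge0.
apply: enorm_le => //.
have -> : inner (\mxcol_i pos_part (v i)) (\mxcol_i pos_part (v i)) =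
    \sum_i enorm (pos_part (v i)) ^+ 2.
  transitivity (((\mxcol_i pos_part (v i))^T *m (\mxcol_i pos_part (v i))) 0 0).
    by rewrite mxE; apply: eq_bigr => k _; rewrite !mxE.
  rewrite tr_mxcol mul_mxrow_mxcol summxE; apply: eq_bigr => i _.
  by rewrite enormE mxE; apply: eq_bigr => k _; rewrite !mxE.
rewrite [leRHS]expr2 mulr_suml; apply: ler_sum => i _.
rewrite expr2 ler_wpM2l ?enorm_ge0// (bigD1 i)//= lerDl.
by apply: sumr_ge0 => j _; exact: enorm_ge0.
Qed.

Lemma vec_le_mxcol (n : nat) (m : 'I_n -> nat) (v : forall i, 'cV[R]_(m i)) :
  vec_le (\mxcol_i v i) 0 -> forall i, pos_part (v i) = 0.
Proof.
move=> h i; apply/colP => k; rewrite !mxE.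
have -> : v i k 0 = (\mxcol_i v i) (tagnat.Rank i k) 0.
  by rewrite -[v i in LHS](mxcolK (fun i => v i)) mxE.
by have := h (tagnat.Rank i k); rewrite [X in _ <= X]mxE => /max_idPr.
Qed.

End Matrices.

(** * Consensus *)

Section Diameter.
Context {R : realType}.
Variables n p : nat.
Implicit Types v : 'I_n -> 'cV[R]_p.

(** Measures the disagreement between agents; the base value 0 of the maximum is harmless because
    norms are nonnegative. *)
Definition diam v : R :=
  \big[Num.max/0]_(ij : 'I_n * 'I_n) enorm (v ij.1 - v ij.2).

Lemma ler_diam v i j : enorm (v i - v j) <= diam v.
Proof. exact: (le_bigmax _ (fun ij : 'I_n * 'I_n => enorm (v ij.1 - v ij.2)) (i, j)). Qed.

Lemma diam_le v c : 0 <= c -> (forall i j, enorm (v i - v j) <= c) -> diam v <= c.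
Proof. by move=> c0 h; apply/bigmax_leP; split=> // -[i j] _; exact: h. Qed.

Lemma diam_ge0 v : 0 <= diam v.
Proof. exact: bigmax_ge_id. Qed.

Definition mix (A : 'M[R]_n) v : 'I_n -> 'cV[R]_p := fun i => \sum_j A i j *: v j.

(* Writing the difference of two rows against the product weights, the diagonal
   terms vanish and carry a total weight of at least [eta]. *)
Lemma mix_contract (A : 'M[R]_n) v eta i k :
  (forall i j, 0 <= A i j) -> (forall i, \sum_j A i j = 1) ->
  (forall i j, eta <= A i j) ->
  enorm (mix A v i - mix A v k) <= (1 - eta) * diam v.
Proof.
move=> A0 A1 Aeta.
have -> : mix A v i - mix A v k =
    \sum_j \sum_l (A i j * A k l) *: (v j - v l).
  transitivity (\sum_j \sum_l ((A i j * A k l) *: v j - (A i j * A k l) *: v l)).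
    under eq_bigr do rewrite sumrB; rewrite sumrB; congr (_ - _).
      apply: eq_bigr => j _; rewrite -scaler_suml -mulr_sumr.
      by rewrite A1 mulr1.
    rewrite exchange_big; apply: eq_bigr => l _ /=.
    by rewrite -scaler_suml -mulr_suml A1 mul1r.
  by apply: eq_bigr => j _; apply: eq_bigr => l _; rewrite scalerBr.
apply: (@le_trans _ _ (\sum_j \sum_l (A i j * A k l) * (diam v *+ (l != j)))).
  rewrite (le_trans (ler_enorm_sum _ _ _))//; apply: ler_sum => j _.
  rewrite (le_trans (ler_enorm_sum _ _ _))//; apply: ler_sum => l _.
  rewrite enormZ ger0_norm ?mulr_ge0// ler_wpM2l ?mulr_ge0//.
  by have [->|_] := eqVneq l j; rewrite ?subrr ?enorm0// mulr1n ler_diam.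
have E j : \sum_l (A i j * A k l) * (diam v *+ (l != j)) =
    A i j * ((1 - A k j) * diam v).
  rewrite -[in RHS](A1 k) (bigD1 j)//= eqxx mulr0n mulr0 add0r.
  rewrite [in RHS](bigD1 j)//= [_ + _ - _]addrAC subrr add0r mulr_suml mulr_sumr.
  by apply: eq_bigr => l lj; rewrite lj mulr1n mulrA.
under eq_bigr do rewrite E.
rewrite -[leRHS]mul1r -(A1 i) mulr_suml; apply: ler_sum => j _.
by rewrite ler_wpM2l// ler_wpM2r ?diam_ge0// lerD2l lerN2.
Qed.

End Diameter.

(** * Lower bounds on products of mixing matrices *)

Section Products.
Context {R : realType}.
Variables (n : nat) (E : nat -> rel 'I_n) (W : nat -> 'M[R]_n) (w : R) (B : nat).
Hypotheses (mixing : mixing_of_graph E W) (A2 : Assumption2 E W w B).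

Fixpoint transition (t k : nat) : 'M[R]_n :=
  if k is k'.+1 then W (t + k') *m transition t k' else 1%:M.

Lemma transition_ge0 t k i j : (0 < t)%N -> 0 <= transition t k i j.
Proof.
move=> t0; elim: k i j => [|k IH] i j /=; first by rewrite mxE ler0n.
rewrite mxE sumr_ge0// => l _; rewrite mulr_ge0//.
by have [] := A2_stochastic A2 (ltn_addr k t0).
Qed.

Lemma transition_row_sum t k i : (0 < t)%N -> \sum_j transition t k i j = 1.
Proof.
move=> t0; elim: k i => [|k IH] i /=.
  rewrite (bigD1 i)//= mxE eqxx big1 ?addr0// => j ji.
  by rewrite mxE eq_sym (negbTE ji).
have [_ W1 _] := A2_stochastic A2 (ltn_addr k t0).
under eq_bigr do rewrite mxE; rewrite exchange_big /= -(W1 i).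
by apply: eq_bigr => l _; rewrite -mulr_sumr IH mulr1.
Qed.

(** Agents that after [k] rounds give non-negligible weight to the initial value of [j]. The
    threshold loses one factor [w] per round, which is exactly what passing along an edge or a
    self-loop costs. *)
Definition reached t j k : {set 'I_n} := [set i | w ^+ k <= transition t k i j].

Lemma reached_step t j k a b : (0 < t)%N ->
  E (t + k) a b \/ b = a -> a \in reached t j k -> b \in reached t j k.+1.
Proof.
move=> t0 ab; rewrite !inE => ha /=.
have tk0 := ltn_addr k t0; have /andP[w0 _] := A2_w A2.
have [W0 _ _] := A2_stochastic A2 tk0.
rewrite mxE (bigD1 a)//= (@le_trans _ _ (W (t + k)%N b a * transition t k a j))//.
  rewrite exprS; apply: ler_pM; rewrite ?exprn_ge0 ?(ltW w0)//.
  by apply: (A2_lower A2) => //; have [+ _] := mixing tk0 b a; apply.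
by rewrite lerDl sumr_ge0// => l _; rewrite mulr_ge0// transition_ge0.
Qed.

Lemma reached_mono t j k l : (0 < t)%N -> reached t j k \subset reached t j (k + l).
Proof.
move=> t0; elim: l => [|l IH]; first by rewrite addn0.
apply: (fintype.subset_trans IH); apply/fintype.subsetP => i hi.
by rewrite addnS; apply: reached_step hi => //; right.
Qed.

Lemma reached_self t j k : (0 < t)%N -> j \in reached t j k.
Proof.
move=> t0; apply: (fintype.subsetP (@reached_mono t j 0 k t0)).
by rewrite inE expr0 mxE eqxx.
Qed.

(** If the set stayed the same for [B] rounds, it would be closed under every edge of the union
    graph of these rounds, and strong connectivity would spread it from [j] to all agents. *)
Lemma reached_grow t j k : (0 < t)%N -> reached t j k != [set: 'I_n]%SET ->
  reached t j k \proper reached t j (k + B).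
Proof.
move=> t0 nT; rewrite fintype.properE reached_mono//=; apply: contraNN nT => sub.
rewrite finset.eqEsubset finset.subsetT /=; apply/fintype.subsetP => i _.
have tk0 := ltn_addr k t0.
have /connectP[s0 hs0 ->] := A2_connected A2 tk0 j i.
suff closed a s : path (fun a b => [exists l : 'I_B, E (t + k + l)%N a b]) a s ->
    a \in reached t j k -> last a s \in reached t j k.
  by apply: closed hs0 _; exact: reached_self.
elim: s a => //= b s IH a /andP[/existsP[l ab] hs] ha.
apply: IH hs _; apply: (fintype.subsetP sub).
(* Self-loops keep [a] in the set until round [k + l], when the edge to [b] is present; they then
   keep [b] until round [k + B]. *)
have hb : b \in reached t j (k + l).+1.
  apply: (@reached_step t j (k + l) a) => //; first by left; rewrite addnA.
  exact: (fintype.subsetP (@reached_mono t j k l t0)).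
have := fintype.subsetP (@reached_mono t j (k + l).+1 (B - l.+1) t0) _ hb.
by rewrite -addnS -addnA subnKC.
Qed.

(** Until it is full, the set gains an agent in every [B] rounds; after [n * B] rounds it would
    otherwise have more than [n] members. *)
Lemma transition_lower t i j : (0 < t)%N ->
  w ^+ (n * B) <= transition t (n * B) i j.
Proof.
move=> t0.
have H N : (N < #|reached t j (N * B)|)%N \/ reached t j (N * B) = [set: 'I_n]%SET.
  elim: N => [|N IH].
    by left; apply/card_gt0P; exists j; exact: reached_self.
  rewrite mulSn addnC.
  have [full|nT] := eqVneq (reached t j (N * B)) [set: 'I_n]%SET.
    right; apply/eqP; rewrite finset.eqEsubset finset.subsetT /= -full.
    exact: reached_mono.
  left; case: IH => [h|h]; last by rewrite h eqxx in nT.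
  by apply: leq_ltn_trans h _; exact/fintype.proper_card/reached_grow.
have [h|h] := H n; last by have := finset.in_setT i; rewrite -h inE.
have := max_card (mem (reached t j (n * B))); rewrite card_ord leqNgt.
by rewrite h.
Qed.

End Products.

(** * Averaging with perturbations *)

Section Perturbed.
Context {R : realType}.

(** The first [L] terms cost at most [L%:R * M]. In the others the contraction is summed, each [e t]
    occurring in at most [L] windows, and the resulting multiple [rho] of the whole sum moves to the
    left. *)
Lemma geometric_sum_bound (D e : nat -> R) (L : nat) (rho M : R) :
  rho < 1 -> 0 <= M -> (forall t, 0 <= D t <= M) -> (forall t, 0 <= e t) ->
  0 <= rho ->
  (forall t, D (L + t)%N <= rho * D t + 2 * \sum_(l < L) e (t + l)%N) ->
  forall T, \sum_(t < T) D t <=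
    (1 - rho)^-1 * (L%:R * M + 2 * L%:R * \sum_(t < T) e t).
Proof.
move=> rho1 M0 DM e0 rho0 DL T.
have D0 t : 0 <= D t by case/andP: (DM t).
have sD k l : (k <= l)%N -> \sum_(t < k) D t <= \sum_(t < l) D t.
  move=> kl; rewrite -!(big_mkord xpredT) (big_cat_nat (leq0n k) kl)//= lerDl.
  by rewrite sumr_ge0.
have se k l : (k <= l)%N -> \sum_(t < k) e t <= \sum_(t < l) e t.
  move=> kl; rewrite -!(big_mkord xpredT) (big_cat_nat (leq0n k) kl)//= lerDl.
  by rewrite sumr_ge0.
rewrite ler_pdivlMl ?subr_gt0//.
have head : \sum_(t < L) D t <= L%:R * M.
  apply: (@le_trans _ _ (\sum_(t < L) M)).
    by apply: ler_sum => t _; case/andP: (DM t).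
  by rewrite sumr_const card_ord mulr_natl.
have split_sum : \sum_(t < T) D t <=
    L%:R * M + \sum_(t < T - L) D (L + t)%N.
  have [TL|/ltnW LT] := leqP T L.
    rewrite (le_trans (sD _ _ TL))// (le_trans head)// lerDl.
    by rewrite sumr_ge0.
  rewrite -[in leLHS](subnKC LT) big_split_ord /= lerD2r.
  exact: head.
have shifted : \sum_(t < T - L) D (L + t)%N <=
    rho * \sum_(t < T) D t + 2 * L%:R * \sum_(t < T) e t.
  apply: (@le_trans _ _ (\sum_(t < T - L) (rho * D t + 2 * \sum_(l < L) e (t + l)%N))).
    exact: ler_sum.
  rewrite big_split /= -!mulr_sumr lerD//.
    by rewrite ler_wpM2l// sD// leq_subr.
  rewrite -mulrA ler_wpM2l// exchange_big /=.
  apply: (@le_trans _ _ (\sum_(l < L) \sum_(t < T) e t)); last first.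
    by rewrite sumr_const card_ord mulr_natl.
  apply: ler_sum => l _.
  have [TL|LT] := leqP T L.
    by rewrite (eqP TL) big_ord0 sumr_ge0.
  (* The window shifted by [l] is completed to start at 0; as [l < L], it still ends before [T]. *)
  apply: (@le_trans _ _ (\sum_(t < l + (T - L)) e t)).
    rewrite big_split_ord /= -[leLHS]add0r lerD ?sumr_ge0//.
    by apply: ler_sum => t _; rewrite addnC.
  by apply: se; rewrite -leq_subRL ?leq_sub2l// ltnW// (leq_trans (ltn_ord l))// ltnW.
by move: split_sum shifted; lra.
Qed.

Variables (n p : nat) (E : nat -> rel 'I_n) (W : nat -> 'M[R]_n) (w : R) (B : nat).
Hypotheses (mixing : mixing_of_graph E W) (A2 : Assumption2 E W w B).

Section Trajectory.
Variables v d : nat -> 'I_n -> 'cV[R]_p.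
Hypothesis vS : forall t i, (0 < t)%N ->
  v t.+1 i = mix (W t) (v t) i + d t i.

Let e t := \sum_i enorm (d t i).

(** Averaging with stochastic rows does not enlarge an error bound common to all agents. That is why
    [e] sums the perturbations over the agents. *)
Lemma perturbed_transition t k i : (0 < t)%N ->
  enorm (v (t + k)%N i - mix (transition W t k) (v t) i) <=
  \sum_(l < k) e (t + l)%N.
Proof.
move=> t0; elim: k i => [|k IH] i.
  rewrite big_ord0 addn0 /mix /= (bigD1 i)//= mxE eqxx scale1r big1 ?addr0.
    by rewrite subrr enorm0.
  by move=> j ji; rewrite mxE eq_sym (negbTE ji) scale0r.
rewrite addnS vS ?ltn_addr// big_ord_recr /=.
have -> : mix (W (t + k)%N *m transition W t k) (v t) i =
    mix (W (t + k)%N) (mix (transition W t k) (v t)) i.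
  rewrite /mix; under [RHS]eq_bigr do rewrite scaler_sumr.
  rewrite exchange_big /=; apply: eq_bigr => j _.
  rewrite mxE scaler_suml; apply: eq_bigr => l _; by rewrite scalerA.
rewrite addrAC (le_trans (ler_enormD _ _))// lerD//; last first.
  by rewrite /e (bigD1 i)//= lerDl sumr_ge0// => j _; exact: enorm_ge0.
rewrite /mix -sumrB; have [W0 W1 _] := A2_stochastic A2 (ltn_addr k t0).
rewrite (le_trans (ler_enorm_sum _ _ _))//.
rewrite -[leRHS]mul1r -(W1 i) mulr_suml; apply: ler_sum => j _.
by rewrite -scalerBr enormZ ger0_norm// ler_wpM2l.
Qed.

(** Doeblin contraction over [n * B] rounds; the accumulated perturbation enters once for each of
    the two agents compared. *)
Lemma diam_window t : (0 < t)%N ->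
  diam (v (t + n * B)%N) <=
  (1 - w ^+ (n * B)) * diam (v t) + 2 * \sum_(l < n * B) e (t + l)%N.
Proof.
move=> t0; have /andP[w0 w1] := A2_w A2.
have e0 l : 0 <= e l by apply: sumr_ge0 => i _; exact: enorm_ge0.
have wL : w ^+ (n * B) <= 1 by rewrite exprn_ile1// ltW.
apply: diam_le.
  by rewrite addr_ge0 ?mulr_ge0 ?diam_ge0 ?subr_ge0// sumr_ge0.
move=> i j; set A := transition W t (n * B).
have hi := perturbed_transition (n * B) i t0.
have hj := perturbed_transition (n * B) j t0.
have := @mix_contract _ _ _ A (v t) (w ^+ (n * B)) i j
   (fun i j => transition_ge0 A2 _ i j t0) (fun i => transition_row_sum A2 _ i t0)
   (fun i j => transition_lower mixing A2 i j t0).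
have := ler_enorm_dist (mix A (v t) i) (v (t + n * B)%N i) (v (t + n * B)%N j).
have := ler_enorm_dist (mix A (v t) j) (mix A (v t) i) (v (t + n * B)%N j).
rewrite (enormBC (mix A (v t) j) (v _ j)).
by move: hi hj; rewrite -/A; lra.
Qed.

End Trajectory.

(** The constant is chosen before the trajectory: it depends on [n], [B] and [w] only. *)
Lemma consensus : exists2 c : R, 0 <= c &
  forall (v d : nat -> 'I_n -> 'cV[R]_p) (M : R),
  (forall t i, (0 < t)%N -> v t.+1 i = mix (W t) (v t) i + d t i) ->
  (forall t, (0 < t)%N -> diam (v t) <= M) ->
  forall T, \sum_(t < T) diam (v t.+1) <=
    c * (M + \sum_(t < T) \sum_i enorm (d t.+1 i)).
Proof.
have /andP[w0 w1] := A2_w A2.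
pose L := (n * B)%N; pose rho := 1 - w ^+ L.
have rho1 : rho < 1 by rewrite ltrBlDr ltrDl exprn_gt0.
have rho0 : 0 <= rho by rewrite subr_ge0 exprn_ile1// ltW.
exists ((1 - rho)^-1 * (2 * L%:R)).
  by rewrite !mulr_ge0// invr_ge0 subr_ge0 ltW.
move=> v d M vS vM T.
have M0 : 0 <= M by rewrite (le_trans (diam_ge0 (v 1%N)))// vM.
have e0 t : 0 <= \sum_i enorm (d t.+1 i) by apply: sumr_ge0 => i _; exact: enorm_ge0.
apply: (le_trans (@geometric_sum_bound (fun t => diam (v t.+1))
   (fun t => \sum_i enorm (d t.+1 i)) L rho M rho1 M0 _ e0 rho0 _ T)).
- by move=> t; rewrite diam_ge0 vM.
- move=> t; have := diam_window vS (ltn0Sn t).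
  by rewrite addSn addnC -/L -/rho.
- rewrite -[leRHS]mulrA ler_wpM2l ?invr_ge0 ?subr_ge0 ?(ltW rho1)//.
  have : 0 <= L%:R * M by rewrite mulr_ge0.
  by rewrite mulrDr; lra.
Qed.

End Perturbed.

(** * Growth of the step sizes *)

Section RealSequences.
Context {R : realType}.
Implicit Types (s theta x : R) (t T : nat).

Lemma ln_le_sub1 x : 0 < x -> ln x <= x - 1.
Proof.
move=> x0; have : -1 < x - 1 by lra.
by move=> /le_ln1Dx; rewrite addrC subrK.
Qed.

Lemma ln_ge_1subV x : 0 < x -> 1 - x^-1 <= ln x.
Proof.
move=> x0; have := @ln_le_sub1 x^-1; rewrite invr_gt0 x0 lnV ?posrE//.
by move=> /(_ isT); lra.
Qed.

(** With [u] the right-hand side, [ln y <= y - 1] is applied at [x / u] with weight [s] and at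
    [u^-1] with weight [1 - s]; the weighted right-hand sides cancel exactly. *)
Lemma powR_bernoulli s x : 0 <= s <= 1 -> 0 < x -> x `^ s <= 1 + s * (x - 1).
Proof.
move=> /andP[s0 s1] x0; set u := 1 + _.
have u0 : 0 < u by rewrite /u; nra.
rewrite -(lnK (x := u)) ?posrE// /powR gt_eqF// ler_expR.
have h1 : ln (x / u) <= x / u - 1 by rewrite ln_le_sub1// divr_gt0.
have h2 : ln u^-1 <= u^-1 - 1 by rewrite ln_le_sub1// invr_gt0.
move: h1 h2; rewrite ln_div ?lnV ?posrE// => h1 h2.
have e : s * (x / u - 1) + (1 - s) * (u^-1 - 1) = 0.
  have -> : s * (x / u - 1) + (1 - s) * (u^-1 - 1) = (s * x + (1 - s)) / u - 1 by ring.
  by rewrite (_ : s * x + (1 - s) = u) ?divff ?gt_eqF ?subrr// /u; ring.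
have : s * (ln x - ln u) + (1 - s) * (- ln u) <= 0.
  by rewrite -e lerD// ler_wpM2l ?subr_ge0.
lra.
Qed.

Lemma powRB1 s x : 0 < x -> x `^ (s - 1) = x `^ s / x.
Proof.
by move=> x0; rewrite powRB ?powRr1 ?(ltW x0)// (gt_eqF x0) implybT.
Qed.

Lemma powR1D s x : 0 < x -> x `^ (1 + s) = x * x `^ s.
Proof.
by move=> x0; rewrite powRD ?powRr1 ?(ltW x0)// (gt_eqF x0) implybT.
Qed.

(** Bernoulli at the ratio of [t] to [t.+1], multiplied by [t.+1%:R] to the power [s]. The case
    [t = 0] is separate and uses that 0 to a positive power is 0. *)
Lemma powR_increment s t : 0 < s <= 1 ->
  s * t.+1%:R `^ (s - 1) <= t.+1%:R `^ s - t%:R `^ s.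
Proof.
move=> /andP[s0 s1]; set x : R := t.+1%:R.
have x0 : 0 < x by rewrite ltr0n.
rewrite powRB1//.
case: t @x x0 => [|t] x x0.
  by rewrite powR0 ?gt_eqF// /x powR1 divr1 mulr1 subr0.
have -> : t.+1%:R `^ s = x `^ s * (t.+1%:R / x) `^ s.
  by rewrite -powRM ?divr_ge0// ?ltW// mulrC divfK ?gt_eqF.
have yx : 0 < t.+1%:R / x by rewrite divr_gt0// ltr0n.
have := powR_bernoulli (introT andP (conj (ltW s0) s1)) yx.
have -> : t.+1%:R / x - 1 = - x^-1.
  have -> : t.+1%:R = x - 1 by rewrite /x -[t.+2]addn1 natrD addrK.
  by rewrite mulrBl divff ?gt_eqF// mul1r addrAC subrr add0r.
have p0 : 0 <= x `^ s by exact: powR_ge0.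
move=> h; have := ler_wpM2l p0 h.
by move: (x^-1) ((_ / x) `^ s) (x `^ s) => a b c; lra.
Qed.

Lemma sum_powR s T : 0 < s <= 1 ->
  \sum_(t < T) t.+1%:R `^ (s - 1) <= T%:R `^ s / s.
Proof.
move=> s01; have /andP[s0 _] := s01; rewrite ler_pdivlMr//.
elim: T => [|T IH]; first by rewrite big_ord0 mul0r powR_ge0.
rewrite big_ord_recr mulrDl /=; have := powR_increment T s01.
by rewrite mulrC; lra.
Qed.

Lemma sum_powR_gt1 theta T : 1 < theta ->
  \sum_(t < T) t.+1%:R `^ (- theta) <= 1 + (theta - 1)^-1.
Proof.
move=> th; have d0 : 0 < theta - 1 by lra.
(* The induction keeps the exact value of the comparison integral from 1 to [T.+1]; its negative
   term is dropped only at the end. *)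
suff H : \sum_(t < T.+1) t.+1%:R `^ (- theta) <=
    1 + (theta - 1)^-1 * (1 - T.+1%:R `^ (1 - theta)).
  case: T H => [_|T H].
    by rewrite big_ord0 addr_ge0// invr_ge0 ltW.
  apply: le_trans (_ : _ <= \sum_(t < T.+2) t.+1%:R `^ (- theta)) _.
    by rewrite [leRHS]big_ord_recr lerDl powR_ge0.
  rewrite (le_trans H)// lerD2l mulrBr mulr1 gerBl.
  by rewrite mulr_ge0 ?powR_ge0// invr_ge0 ltW.
elim: T => [|T IH].
  by rewrite big_ord_recl big_ord0 !powR1 subrr mulr0.
rewrite big_ord_recr /=.
set x : R := T.+2%:R; have x0 : 0 < x by rewrite ltr0n.
set y : R := T.+1%:R in IH *; have y0 : 0 < y by rewrite ltr0n.
have xy : y = x - 1 by rewrite /x -[T.+2]addn1 natrD addrK.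
have key : (theta - 1) * x `^ (- theta) <= y `^ (1 - theta) - x `^ (1 - theta).
  have -> : x `^ (- theta) = x `^ (1 - theta) / x.
    by rewrite -powRB1//; congr (_ `^ _); ring.
  have -> : y `^ (1 - theta) = x `^ (1 - theta) * (y / x) `^ (1 - theta).
    by rewrite -powRM ?divr_ge0// ?ltW// mulrC divfK ?gt_eqF.
  have p0 : 0 <= x `^ (1 - theta) by exact: powR_ge0.
  have : 1 + (theta - 1) / x <= (y / x) `^ (1 - theta).
    have yx : 0 < y / x by rewrite divr_gt0.
    rewrite /powR gt_eqF//; apply: le_trans (expR_ge1Dx _).
    have : x^-1 <= - ln (y / x).
      have e : - (y / x - 1) = x^-1.
        by rewrite [in LHS]xy mulrBl divff ?gt_eqF// mul1r addrAC subrr add0r opprK.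
      by rewrite -[leLHS]e lerN2 ln_le_sub1.
    move=> h; have := ler_wpM2l (ltW d0) h.
    by move: (x^-1) (ln _) => b a; lra.
  move=> h; have := ler_wpM2l p0 h.
  by move: (x^-1) ((y / x) `^ _) (x `^ _) => a b c; lra.
have key2 : x `^ (- theta) <= (theta - 1)^-1 * (y `^ (1 - theta) - x `^ (1 - theta)).
  by rewrite ler_pdivlMl.
by move: IH key2; rewrite !mulrBr; lra.
Qed.

Lemma ln_increment x : 0 < x -> (x + 1)^-1 <= ln (x + 1) - ln x <= x^-1.
Proof.
move=> x0; have x1 : 0 < x + 1 by lra.
rewrite -ln_div ?posrE//; apply/andP; split.
  have := ln_ge_1subV (divr_gt0 x1 x0); rewrite invf_div.
  by rewrite -[X in X - _ <= _](divff (lt0r_neq0 x1)) -mulrBl addrAC subrr add0r div1r.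
have := ln_le_sub1 (divr_gt0 x1 x0).
by rewrite -[X in _ <= _ - X](divff (lt0r_neq0 x0)) -mulrBl addrAC subrr add0r div1r.
Qed.

Lemma sum_inv_le T : (0 < T)%N -> \sum_(t < T) t.+1%:R^-1 <= 1 + ln T%:R :> R.
Proof.
case: T => // T _; elim: T => [|T IH].
  by rewrite big_ord_recl big_ord0 invr1 ln1.
rewrite big_ord_recr /= -[T.+2]addn1 natrD.
have := @ln_increment T.+1%:R; rewrite ltr0n => /(_ isT)/andP[+ _].
by move: IH; move: (_^-1) (\sum_(_ < _) _) (ln (_ + _)) (ln _) => a b c d; lra.
Qed.

Lemma sum_inv_ge T : ln T.+1%:R <= \sum_(t < T) t.+1%:R^-1 :> R.
Proof.
elim: T => [|T IH]; first by rewrite ln1 big_ord0.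
rewrite big_ord_recr /= -[T.+2]addn1 natrD.
have := @ln_increment T.+1%:R; rewrite ltr0n => /(_ isT)/andP[_].
by move: IH; move: (_^-1) (\sum_(_ < _) _) (ln (_ + _)) (ln _) => a b c d; lra.
Qed.

(** With [U] and [V] consecutive partial sums, [u T] is the difference of the squares of their
    roots, hence at most twice the root of [V] times the difference of the roots, and this
    telescopes. *)
Lemma sum_sqrt (u : nat -> R) T : (forall t, 0 <= u t) -> 0 < u 0%N ->
  \sum_(t < T) u t / Num.sqrt (\sum_(l < t.+1) u l) <=
  2 * Num.sqrt (\sum_(l < T) u l).
Proof.
move=> u0 u1; elim: T => [|T IH]; first by rewrite !big_ord0 sqrtr0 mulr0.
rewrite [leLHS]big_ord_recr /= (le_trans (lerD IH (lexx _)))//.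
rewrite -lerBrDl -mulrBr.
set U := \sum_(l < T) u l; set V := \sum_(l < T.+1) u l.
have U0 : 0 <= U by exact: sumr_ge0.
have V0 : 0 < V.
  by rewrite /V big_ord_recl; apply: ltr_wpDr => //; exact: sumr_ge0.
have -> : u T = Num.sqrt V ^+ 2 - Num.sqrt U ^+ 2.
  by rewrite !sqr_sqrtr ?(ltW V0)// /V big_ord_recr /= addrAC subrr add0r.
have : Num.sqrt U <= Num.sqrt V.
  by rewrite ler_wsqrtr// /V big_ord_recr lerDl.
have v0 : 0 < Num.sqrt V by rewrite sqrtr_gt0.
rewrite ler_pdivrMr//; have := sqrtr_ge0 U; nra.
Qed.

End RealSequences.

(** * Sums of thresholds and step sizes, and the rates in the three regimes *)

Section StepSizes.
Context {R : realType}.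
Variable theta : R.
Hypothesis theta_gt0 : 0 < theta.
Implicit Types t T : nat.

Definition psi T : R := \sum_(s < T) s.+1%:R `^ (- theta).

(** The geometric mean of [T] and [psi T], written Q_T in the outline. *)
Definition psi_mean T : R := Num.sqrt (T%:R * psi T).

Definition step T : R := Num.sqrt (psi T / T%:R).

Let natr_gt0 T : (0 < T)%N -> 0 < T%:R :> R. Proof. by rewrite ltr0n. Qed.

Lemma threshold_antitone s t : (0 < s <= t)%N -> t%:R `^ (- theta) <= s%:R `^ (- theta).
Proof.
move=> /andP[s0 st]; have t0 := leq_trans s0 st.
rewrite !powRN lef_pV2 ?posrE ?powR_gt0 ?natr_gt0//.
by rewrite ge0_ler_powR ?nnegrE ?ler_nat// ltW.
Qed.

Lemma psi_ge1 T : (0 < T)%N -> 1 <= psi T.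
Proof.
case: T => // T _; rewrite /psi big_ord_recl powR1 lerDl.
by apply: sumr_ge0 => t _; exact: powR_ge0.
Qed.

Lemma psi_ge0 T : 0 <= psi T.
Proof. by apply: sumr_ge0 => t _; exact: powR_ge0. Qed.

Lemma psi_gt0 T : (0 < T)%N -> 0 < psi T.
Proof. by move=> /psi_ge1; apply: lt_le_trans. Qed.

Lemma psi_le T : psi T <= T%:R.
Proof.
rewrite -[X in _ <= X%:R](card_ord T) -sum1_card natr_sum; apply: ler_sum => t _.
by rewrite (le_trans (@threshold_antitone 1 _ _))// powR1.
Qed.

Lemma psi_ge_last T t : (T <= t)%N -> T%:R * t%:R `^ (- theta) <= psi T.
Proof.
move=> Tt; rewrite mulr_natl -[X in _ *+ X](card_ord T) -sumr_const.
by apply: ler_sum => s _; rewrite threshold_antitone//= (leq_trans (ltn_ord s)).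
Qed.

Lemma psi_mono T T' : (T <= T')%N -> psi T <= psi T'.
Proof.
move=> TT; rewrite /psi -!(big_mkord xpredT (fun s => s.+1%:R `^ (- theta))).
rewrite (big_cat_nat (leq0n T) TT)//= lerDl.
by apply: sumr_ge0 => t _; exact: powR_ge0.
Qed.

Lemma step_gt0 T : (0 < T)%N -> 0 < step T.
Proof. by move=> T0; rewrite sqrtr_gt0 divr_gt0 ?psi_gt0 ?natr_gt0. Qed.

(** [psi T / T%:R] is the mean of the first terms of a non-increasing sequence, so a further term
    cannot raise it. *)
Lemma step_antitone T : (0 < T)%N -> step T.+1 <= step T.
Proof.
move=> T0; have [t0 s0] := (natr_gt0 T0, psi_gt0 T0).
rewrite ler_sqrt ?divr_ge0 ?psi_ge0 ?ler0n//.
rewrite ler_pdivrMr ?ltr0n// mulrAC ler_pdivlMr// /psi big_ord_recr /= -/(psi T).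
have := psi_ge_last (leqnSn T); rewrite -natr1; lra.
Qed.

(** Each [psi t.+1] is replaced by [psi T], which leaves a sum of inverse square roots: [sum_sqrt]
    for the constant sequence 1. *)
Lemma sum_step T : \sum_(t < T) step t.+1 <= 2 * psi_mean T.
Proof.
rewrite /psi_mean sqrtrM ?ler0n// mulrA mulrAC.
have h := @sum_sqrt R (fun=> 1) T (fun=> ler01) ltr01.
have sE k : \sum_(l < k) (1 : R) = k%:R by rewrite sumr_const card_ord.
rewrite sE in h.
apply: le_trans (_ : (\sum_(t < T) 1 / Num.sqrt (\sum_(l < t.+1) 1)) * Num.sqrt (psi T) <= _); last first.
  by rewrite mulrAC ler_wpM2r ?sqrtr_ge0.
rewrite mulr_suml; apply: ler_sum => t _.
rewrite sE div1r /step sqrtrM ?psi_ge0// sqrtrV ?ler0n// mulrC.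
by rewrite ler_wpM2l ?invr_ge0 ?sqrtr_ge0// ler_wsqrtr// psi_mono.
Qed.

(** [psi] is monotone and [T.+1] is at most four times [T]; the factor 2 is the root of 4. *)
Lemma inv_step T : (0 < T)%N -> (step T.+1)^-1 <= 2 * Num.sqrt (T%:R / psi T).
Proof.
move=> T0; have [t0 s0] := (natr_gt0 T0, psi_gt0 T0).
have s1 : 0 < psi T.+1 by exact: psi_gt0.
rewrite -sqrtrV ?divr_ge0 ?ler0n ?psi_ge0// invf_div.
have -> : 2 = Num.sqrt (2 ^+ 2) :> R by rewrite sqrtr_sqr ger0_norm.
rewrite -sqrtrM ?sqr_ge0// ler_wsqrtr// mulrA.
apply: ler_pM; rewrite ?ler0n ?invr_ge0 ?(ltW s1)//.
  have : (1 : R) <= T%:R by rewrite ler1n.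
  by rewrite -natr1; lra.
by rewrite lef_pV2 ?posrE// psi_mono.
Qed.

(** By [inv_step] the inverse step costs the root of [T] over that of [psi t.+1], and the thresholds
    are the increments of [psi], so [sum_sqrt] applies again. *)
Lemma sum_threshold_step T :
  \sum_(t < T) t.+1%:R `^ (- theta) / step t.+2 <= 4 * psi_mean T.
Proof.
have h := @sum_sqrt R (fun t => t.+1%:R `^ (- theta)) T
  (fun=> powR_ge0 _ _) (powR_gt0 _ ltr01).
apply: le_trans (_ : 2 * Num.sqrt T%:R * (\sum_(t < T) t.+1%:R `^ (- theta) /
   Num.sqrt (\sum_(l < t.+1) l.+1%:R `^ (- theta))) <= _).
  rewrite mulr_sumr; apply: ler_sum => t _; rewrite mulrCA ler_wpM2l ?powR_ge0//.
  rewrite (le_trans (inv_step _))// -mulrA ler_wpM2l//.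
  rewrite sqrtrM ?ler0n// sqrtrV ?psi_ge0//.
  by rewrite ler_wpM2r ?invr_ge0 ?sqrtr_ge0// ler_wsqrtr// ler_nat.
have -> : 4 * psi_mean T = 2 * Num.sqrt T%:R * (2 * Num.sqrt (psi T)).
  by rewrite /psi_mean sqrtrM ?ler0n//; ring.
by rewrite ler_wpM2l ?mulr_ge0 ?sqrtr_ge0.
Qed.

Lemma inv_step_le_mean T : (0 < T)%N -> Num.sqrt (T%:R / psi T) <= psi_mean T.
Proof.
move=> T0; rewrite ler_wsqrtr// ler_wpM2l// (le_trans _ (psi_ge1 T0))//.
by rewrite invf_le1 ?psi_gt0// psi_ge1.
Qed.

Lemma psi_le_mean T : psi T <= psi_mean T.
Proof.
rewrite -ler_sqr ?nnegrE ?psi_ge0 ?sqrtr_ge0// sqr_sqrtr ?mulr_ge0 ?psi_ge0//.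
by rewrite expr2 ler_wpM2r ?psi_ge0 ?psi_le.
Qed.

Lemma psi_mean_ge1 T : (0 < T)%N -> 1 <= psi_mean T.
Proof. by move=> T0; rewrite (le_trans (psi_ge1 T0))// psi_le_mean. Qed.

Lemma psi_mean_le T : psi_mean T <= T%:R.
Proof.
rewrite -ler_sqr ?nnegrE ?sqrtr_ge0// sqr_sqrtr ?mulr_ge0 ?psi_ge0//.
by rewrite expr2 ler_wpM2l ?psi_le.
Qed.

Lemma psi_mean_le_of c s T : (0 < T)%N -> 0 <= c -> psi T <= c * T%:R `^ s ->
  psi_mean T <= Num.sqrt c * T%:R `^ ((1 + s) / 2).
Proof.
move=> T0 c0 h; rewrite powRrM powR12_sqrt ?powR_ge0// -sqrtrM//.
rewrite ler_wsqrtr// powR1D ?natr_gt0// mulrCA.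
by rewrite ler_wpM2l.
Qed.

Lemma psi_le_lt1 T : theta < 1 -> psi T <= (1 - theta)^-1 * T%:R `^ (1 - theta).
Proof.
move=> th; have := @sum_powR R (1 - theta) T; rewrite addrAC subrr add0r.
by rewrite mulrC; apply; rewrite subr_gt0 th gerBl ltW.
Qed.

Lemma psi_ratio_lt1 T : (0 < T)%N -> Num.sqrt (T%:R / psi T) <= T%:R `^ (theta / 2).
Proof.
move=> T0; rewrite powRrM powR12_sqrt ?powR_ge0// ler_wsqrtr//.
rewrite ler_pdivrMr ?psi_gt0//; have := psi_ge_last (leqnn T).
rewrite powRN mulrC ler_pdivrMl ?powR_gt0 ?natr_gt0//.
Qed.

(** From [T = 2] on the logarithm is at least 1/2, so the additive 1 in the upper harmonic bound is
    absorbed by the factor 3. *)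
Lemma psi_eq1 T : theta = 1 -> (1 < T)%N ->
  [/\ 0 < ln (T%:R : R), ln T%:R <= psi T & psi T <= 3 * ln T%:R].
Proof.
move=> th T1; have T0 : (0 < T)%N by exact: ltnW.
have pE : psi T = \sum_(t < T) t.+1%:R^-1.
  by apply: eq_bigr => t _; rewrite th powRN powRr1.
have half : 1 / 2 <= ln (T%:R : R).
  apply: le_trans (ln_ge_1subV (natr_gt0 T0)).
  have : (T%:R : R)^-1 <= 2^-1 by rewrite lef_pV2 ?posrE ?natr_gt0// ler_nat.
  lra.
split; first lra.
  rewrite pE; apply: le_trans (sum_inv_ge T).
  by rewrite ler_ln ?posrE ?ltr0n// ler_nat.
by rewrite pE; apply: (le_trans (sum_inv_le T0)); lra.
Qed.

Lemma reg_rate_ge kappa : exists (C : R) (T0 : nat), 0 < C /\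
  forall T P, (0 < T)%N -> (T0 <= T)%N -> 0 <= P ->
  T%:R `^ kappa + psi_mean T + Num.sqrt (T%:R / psi T) * P <=
  C * reg_rate theta kappa T P.
Proof.
(* [c - 1] will be the constant comparing [psi_mean T] with the main rate [a]; the path term needs
   no constant. *)
have combine c (a b d a' d' : R) : 1 <= c -> 0 <= a -> 0 <= d ->
    b <= (c - 1) * a -> d' <= d -> a' <= a ->
    a' + b + d' <= c * (a + d).
  by move=> *; nra.
have [th|th|th] := ltgtP theta 1.
- exists (1 + Num.sqrt (1 - theta)^-1), 0%N.
  split; first by rewrite ltr_pwDl ?sqrtr_ge0.
  move=> T P T0 _ P0; rewrite /reg_rate th.
  have T1 : 1 <= T%:R :> R by rewrite ler1n.
  apply: combine; rewrite ?powR_ge0 ?mulr_ge0 ?powR_ge0//.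
  + by rewrite lerDl sqrtr_ge0.
  + rewrite addrAC subrr add0r.
    apply: (le_trans (psi_mean_le_of T0 _ (psi_le_lt1 T th))).
      by rewrite invr_ge0; lra.
    rewrite ler_wpM2l ?sqrtr_ge0// ler_powR// le_max; apply/orP; right; lra.
  + by rewrite ler_wpM2r// psi_ratio_lt1.
  + by rewrite ler_powR// le_max lexx.
- exists (1 + Num.sqrt (1 + (theta - 1)^-1)), 0%N.
  split; first by rewrite ltr_pwDl ?sqrtr_ge0.
  move=> T P T0 _ P0; rewrite /reg_rate ltNge (ltW th) /= gt_eqF//.
  have T1 : 1 <= T%:R :> R by rewrite ler1n.
  apply: combine; rewrite ?powR_ge0 ?mulr_ge0 ?powR_ge0//.
  + by rewrite lerDl sqrtr_ge0.
  + rewrite addrAC subrr add0r.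
    have h : psi T <= (1 + (theta - 1)^-1) * T%:R `^ 0.
      by rewrite powRr0 mulr1 sum_powR_gt1.
    apply: (le_trans (psi_mean_le_of T0 _ h)).
      by rewrite addr_ge0// invr_ge0; lra.
    rewrite addr0 ler_wpM2l ?sqrtr_ge0// ler_powR// le_max lexx orbT//.
  + rewrite ler_wpM2r// mul1r powR12_sqrt// ler_wsqrtr// ler_piMr//.
    by rewrite invf_le1 ?psi_gt0// psi_ge1.
  + by rewrite ler_powR// le_max lexx.
(* At [T = 1] the logarithm vanishes and the coefficient of [P] in the rate is a division by zero,
   hence 0; the bound can only start at 2. *)
- exists 3, 2%N; split => // T P T0 T2 P0.
  have [l0 lp pl] := psi_eq1 th T2.
  rewrite /reg_rate th ltxx eqxx.
  have hm : psi_mean T <= 2 * Num.sqrt (T%:R * ln T%:R).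
    have -> : 2 = Num.sqrt (2 ^+ 2) :> R by rewrite sqrtr_sqr ger0_norm.
    rewrite -sqrtrM ?sqr_ge0// ler_wsqrtr// mulrCA ler_wpM2l//.
    by rewrite (le_trans pl)// ler_wpM2r ?(ltW l0)//; lra.
  have hr : Num.sqrt (T%:R / psi T) <= Num.sqrt (T%:R / ln T%:R).
    by rewrite ler_wsqrtr// ler_wpM2l// lef_pV2 ?posrE// psi_gt0.
  have := ler_wpM2r P0 hr; have := powR_ge0 (T%:R : R) kappa.
  have := sqrtr_ge0 (T%:R * ln T%:R : R).
  have := mulr_ge0 (sqrtr_ge0 (T%:R / ln T%:R : R)) P0.
  lra.
Qed.

Lemma ccv_rate_ge kappa : exists (C : R) (T0 : nat), 0 < C /\
  forall T, (0 < T)%N -> (T0 <= T)%N ->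
  T%:R `^ (1 - kappa / 2) + Num.sqrt (psi_mean T * T%:R) <=
  C * ccv_rate theta kappa T.
Proof.
(* Used with [s] the exponent of [psi_mean]: [1 - theta / 2] becomes [1 - theta / 4], and [1 / 2]
   becomes [3 / 4]. *)
have sqrt_mean c s T : (0 < T)%N -> 0 <= c -> psi_mean T <= c * T%:R `^ s ->
    Num.sqrt (psi_mean T * T%:R) <= Num.sqrt c * T%:R `^ ((1 + s) / 2).
  move=> T0 c0 h; rewrite powRrM powR12_sqrt ?powR_ge0// -sqrtrM//.
  rewrite ler_wsqrtr// powR1D ?natr_gt0// mulrCA mulrC.
  by rewrite ler_wpM2l.
have [th|th|th] := ltgtP theta 1.
- exists (1 + Num.sqrt (Num.sqrt (1 - theta)^-1)), 0%N.
  split; first by rewrite ltr_pwDl ?sqrtr_ge0.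
  move=> T T0 _; rewrite /ccv_rate th mulrDl mul1r.
  have T1 : 1 <= T%:R :> R by rewrite ler1n.
  apply: lerD; first by rewrite ler_powR// le_max lexx.
  have i0 : 0 <= (1 - theta)^-1 by rewrite invr_ge0; lra.
  apply: (le_trans (sqrt_mean _ _ _ T0 _ (psi_mean_le_of T0 _ (psi_le_lt1 T th)))) => //.
  by rewrite ler_wpM2l ?sqrtr_ge0// ler_powR// le_max; apply/orP; right; lra.
- exists (1 + Num.sqrt (Num.sqrt (1 + (theta - 1)^-1))), 0%N.
  split; first by rewrite ltr_pwDl ?sqrtr_ge0.
  move=> T T0 _; rewrite /ccv_rate ltNge (ltW th) /= gt_eqF// mulrDl mul1r.
  have T1 : 1 <= T%:R :> R by rewrite ler1n.
  apply: lerD; first by rewrite ler_powR// le_max lexx.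
  have h : psi T <= (1 + (theta - 1)^-1) * T%:R `^ 0.
    by rewrite powRr0 mulr1 sum_powR_gt1.
  have i0 : 0 <= 1 + (theta - 1)^-1 by rewrite addr_ge0// invr_ge0; lra.
  apply: (le_trans (sqrt_mean _ _ _ T0 _ (psi_mean_le_of T0 _ h))) => //.
  by rewrite ler_wpM2l ?sqrtr_ge0// ler_powR// le_max; apply/orP; right; lra.
- exists 2, 2%N; split => // T T0 T2.
  have [l0 lp pl] := psi_eq1 th T2.
  rewrite /ccv_rate th ltxx eqxx.
  have -> : (1 / 4 : R) = 2^-1 * 2^-1 by lra.
  rewrite powRrM !powR12_sqrt ?mulr_ge0 ?sqrtr_ge0 ?exprn_ge0 ?(ltW l0)//.
  rewrite mulrDr lerD//; first by rewrite ler_peMl ?powR_ge0// ler1n.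
  (* The fourth root of 16, which leaves room for the factor 3 of [psi_eq1]. *)
  have -> : 2 = Num.sqrt (Num.sqrt (16 : R)) :> R.
    have -> : 16 = (2 ^+ 2) ^+ 2 :> R by lra.
    by rewrite sqrtr_sqr ger0_norm ?sqr_ge0// sqrtr_sqr ger0_norm.
  rewrite -sqrtrM ?sqrtr_ge0// ler_wsqrtr// -sqrtrM//.
  rewrite -[X in _ * X]ger0_norm// -sqrtr_sqr /psi_mean -sqrtrM ?mulr_ge0 ?psi_ge0//.
  rewrite ler_wsqrtr// mulrCA exprSr.
  have := mulr_ge0 (exprn_ge0 3 (ler0n R T)) (ltW l0).
  have := ler_wpM2l (exprn_ge0 3 (ler0n R T)) pl.
  lra.
Qed.

End StepSizes.

(** * One round of the algorithm *)

Section Jensen.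
Context {R : realType}.

(** The difference of the two sides is the weighted variance of [v]. *)
Lemma weighted_sqr (n : nat) (a v : 'I_n -> R) :
  (forall i, 0 <= a i) -> \sum_i a i = 1 ->
  (\sum_i a i * v i) ^+ 2 <= \sum_i a i * v i ^+ 2.
Proof.
move=> a0 a1; set s := \sum_i a i * v i.
have : 0 <= \sum_i a i * (v i - s) ^+ 2.
  by apply: sumr_ge0 => i _; rewrite mulr_ge0 ?sqr_ge0.
have -> : \sum_i a i * (v i - s) ^+ 2 =
    \sum_i a i * v i ^+ 2 - 2 * s * s + s ^+ 2 * 1.
  transitivity (\sum_i (a i * v i ^+ 2 - 2 * s * (a i * v i) + s ^+ 2 * a i)).
    by apply: eq_bigr => i _; ring.
  by rewrite big_split sumrB /= -!mulr_sumr a1.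
by move=> h; nra.
Qed.

(** Row sums equal to 1 give Jensen for each agent; column sums equal to 1 let the total over the
    agents be preserved. *)
Lemma sum_mix_sqr (n p : nat) (A : 'M[R]_n) (v : 'I_n -> 'cV[R]_p) (y : 'cV[R]_p) :
  doubly_stochastic A ->
  \sum_i enorm (mix A v i - y) ^+ 2 <= \sum_j enorm (v j - y) ^+ 2.
Proof.
move=> [A0 A1 A1'].
apply: (@le_trans _ _ (\sum_i \sum_j A i j * enorm (v j - y) ^+ 2)); last first.
  rewrite exchange_big; apply: ler_sum => j _ /=.
  by rewrite -mulr_suml A1' mul1r.
apply: ler_sum => i _; apply: le_trans (weighted_sqr _ (A0 i) (A1 i)).
have -> : mix A v i - y = \sum_j A i j *: (v j - y).
  rewrite -{1}[y]scale1r -(A1 i) scaler_suml -sumrB.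
  by apply: eq_bigr => j _; rewrite scalerBr.
have S0 : 0 <= \sum_j A i j * enorm (v j - y).
  by apply: sumr_ge0 => j _; rewrite mulr_ge0 ?enorm_ge0.
rewrite ler_sqr ?nnegrE ?enorm_ge0// (le_trans (ler_enorm_sum _ _ _))//.
by apply: ler_sum => j _; rewrite enormZ ger0_norm.
Qed.

Lemma mix_diam (n p : nat) (A : 'M[R]_n) (v : 'I_n -> 'cV[R]_p) i :
  doubly_stochastic A -> enorm (v i - mix A v i) <= diam v.
Proof.
move=> [A0 A1 _].
have -> : v i - mix A v i = \sum_j A i j *: (v i - v j).
  rewrite -{1}[v i]scale1r -(A1 i) scaler_suml -sumrB.
  by apply: eq_bigr => j _; rewrite scalerBr.
rewrite (le_trans (ler_enorm_sum _ _ _))// -[leRHS]mul1r -(A1 i) mulr_suml.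
by apply: ler_sum => j _; rewrite enormZ ger0_norm// ler_wpM2l// ler_diam.
Qed.

End Jensen.

(** * Iterates, multipliers and their drift *)

Section Run.
Context {R : realType} {n p : nat} {m : 'I_n -> nat}.
Variables (X : set 'cV[R]_p) (f : 'I_n -> nat -> 'cV[R]_p -> R)
  (g : forall i : 'I_n, nat -> 'cV[R]_p -> 'cV[R]_(m i))
  (df : 'I_n -> nat -> 'cV[R]_p -> 'cV[R]_p)
  (dg dgp : forall i : 'I_n, nat -> 'cV[R]_p -> 'M[R]_(p, m i))
  (W : nat -> 'M[R]_n) (RX F1 F2 : R) (alpha beta gamma tau : nat -> R)
  (x xhat z omega : 'I_n -> nat -> 'cV[R]_p)
  (q : forall i : 'I_n, nat -> 'cV[R]_(m i)).
Hypotheses (A1 : Assumption1 X f g df dg RX F1 F2)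
  (dgpP : forall (i : 'I_n) (t : nat), (0 < t)%N -> forall x, X x ->
     is_pos_part_subgradient (g i t x) (dg i t x) (dgp i t x))
  (WP : forall t, (0 < t)%N -> doubly_stochastic (W t))
  (tau_ge0 : forall t, (0 < t)%N -> 0 <= tau t)
  (alpha_gt0 : forall t, (0 < t)%N -> 0 < alpha t)
  (beta_gt0 : forall t, (0 < t)%N -> 0 < beta t)
  (gamma_gt0 : forall t, (0 < t)%N -> 0 < gamma t)
  (beta_gamma : forall t, (0 < t)%N -> beta t * gamma t <= 1)
  (beta_antitone : forall t, (0 < t)%N -> beta t.+1 <= beta t)
  (alg : Algorithm1 X g df dgp W alpha beta gamma tau x xhat z omega q).

Lemma iterate_in i t : (0 < t)%N -> X (x i t).
Proof.
case: t => // -[|t] _; first exact: alg_x1 alg i.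
by have [] := alg_x alg i (ltn0Sn t).
Qed.

(** Either the trigger fires and the two points coincide, or it does not because they are closer
    than the threshold. *)
Lemma broadcast_dist i t : (0 < t)%N -> enorm (xhat i t - x i t) <= tau t.
Proof.
case: t => // -[|t] _.
  by rewrite (alg_xhat1 alg) subrr enorm0 tau_ge0.
rewrite (alg_xhat alg)//; case: ifPn => [_|]; first by rewrite subrr enorm0 tau_ge0.
by rewrite -ltNge enormBC => /ltW.
Qed.

Lemma broadcast_in i t : (0 < t)%N -> X (xhat i t).
Proof.
case: t => // t _; elim: t => [|t IH]; first by rewrite (alg_xhat1 alg); exact: alg_x1 alg i.
by rewrite (alg_xhat alg)//; case: ifPn => // _; exact: iterate_in.
Qed.

Lemma diameter u v : X u -> X v -> enorm (u - v) <= 2 * RX.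
Proof.
move=> /(A1_bounded A1) hu /(A1_bounded A1) hv.
by rewrite (le_trans (ler_enormB _ _))//; lra.
Qed.

Lemma diam_broadcast t : (0 < t)%N -> diam (xhat ^~ t) <= 2 * RX.
Proof.
move=> t0; apply: diam_le; first by rewrite mulr_ge0// ltW// (A1_RX A1).
by move=> i j; apply: diameter; exact: broadcast_in.
Qed.

Lemma mix_broadcast i t : (0 < t)%N -> z i t.+1 = mix (W t) (xhat ^~ t) i.
Proof. by move=> t0; rewrite (alg_z alg). Qed.

Lemma dual_ge0 i t k : (0 < t)%N -> 0 <= q i t k 0.
Proof.
case: t => // -[|t] _; first by rewrite (alg_q1 alg) mxE.
by rewrite (alg_q alg)// pos_part_ge0.
Qed.

Lemma dgp_bound i t u : (0 < t)%N -> X u ->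
  (forall v, enorm (dgp i t u *m v) <= F2 * enorm v) /\
  (forall v, enorm ((dgp i t u)^T *m v) <= F2 * enorm v).
Proof.
move=> t0 Xu; have F2ge0 := ltW (A1_F2 A1).
have H v : enorm (dgp i t u *m v) <= F2 * enorm v.
  apply: (enorm_pos_part_subgradient _ (dgpP i t0 Xu)) => //.
  exact: A1_dg_bound A1 i t t0 u Xu.
by split=> //; exact: enorm_tr_mulmx.
Qed.

Lemma pos_part_linearization i t u v k : (0 < t)%N -> X u -> X v ->
  pos_part (g i t u) k 0 + ((dgp i t u)^T *m (v - u)) k 0 <= pos_part (g i t v) k 0.
Proof.
move=> t0 Xu Xv.
have sg l : is_subgradient X (fun v => g i t v l 0) u (col l (dg i t u)).
  exact: A1_dg A1 i t t0 u Xu l.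
exact: (pos_part_subgradientP sg (dgpP i t0 Xu) Xv).
Qed.

(** The linearisation at [u] bounds the nonnegative coordinates at [u] by those of
    [pos_part (g i t v) - D], which allows comparing norms. *)
Lemma enorm_pos_part_lipschitz i t u v : (0 < t)%N -> X u -> X v ->
  enorm (pos_part (g i t u)) <= enorm (pos_part (g i t v)) + F2 * enorm (u - v).
Proof.
move=> t0 Xu Xv; set D := (dgp i t u)^T *m (v - u).
apply: (@le_trans _ _ (enorm (pos_part (g i t v) - D))).
  apply: enorm_le_coord => k; have := pos_part_linearization k t0 Xu Xv.
  rewrite -/D => h; have h0 := pos_part_ge0 (g i t u) k.
  have -> : (pos_part (g i t v) - D) k 0 = pos_part (g i t v) k 0 - D k 0.
    by rewrite [LHS]mxE [X in _ + X]mxE.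
  by rewrite !ger0_norm; lra.
rewrite (le_trans (ler_enormB _ _))// lerD2l enormBC.
by have [_] := dgp_bound i t0 Xu; apply.
Qed.

(** The vector b_t of the outline. *)
Definition linearized i t : 'cV[R]_(m i) :=
  pos_part (g i t (x i t)) + (dgp i t (x i t))^T *m (x i t.+1 - x i t).

Lemma dual_step i t : (0 < t)%N ->
  q i t.+1 = pos_part ((1 - beta t.+1 * gamma t.+1) *: q i t + gamma t.+1 *: linearized i t).
Proof. by move=> t0; rewrite (alg_q alg). Qed.

Lemma enorm_linearized i t : (0 < t)%N -> enorm (linearized i t) <= F1 + F2 * (2 * RX).
Proof.
move=> t0; have Xt := iterate_in i t0; have Xt1 := iterate_in i (ltn0Sn t).
rewrite (le_trans (ler_enormD _ _))// lerD//.
  by rewrite (le_trans (enorm_pos_part _))// (A1_g_bound A1).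
have [_ h] := dgp_bound i t0 Xt; rewrite (le_trans (h _))//.
by rewrite ler_wpM2l ?(ltW (A1_F2 A1))// diameter.
Qed.

(** By convexity [linearized] lies below the positive part of the constraint at the new iterate, of
    norm at most [F1]. Multiplied by [beta], the update bounds the new value by a convex combination
    of [F1] and the old one, as [beta] is non-increasing. *)
Lemma dual_bound i t : (0 < t)%N -> beta t * enorm (q i t) <= F1.
Proof.
case: t => // t _; elim: t => [|t IH].
  by rewrite (alg_q1 alg) enorm0 mulr0 ltW// (A1_F1 A1).
have [b0 b1] := (beta_gt0 (ltn0Sn t), beta_gt0 (ltn0Sn t.+1)).
have g1 := gamma_gt0 (ltn0Sn t.+1); have bg := beta_gamma (ltn0Sn t.+1).
have bb := beta_antitone (ltn0Sn t).
have Xt := iterate_in i (ltn0Sn t); have Xt1 := iterate_in i (ltn0Sn t.+1).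
set G := pos_part (g i t.+1 (x i t.+2)).
have GF : enorm G <= F1.
  by rewrite (le_trans (enorm_pos_part _))// (A1_g_bound A1).
have h : enorm (q i t.+2) <= (1 - beta t.+2 * gamma t.+2) * enorm (q i t.+1) + gamma t.+2 * F1.
  apply: (@le_trans _ _ (enorm ((1 - beta t.+2 * gamma t.+2) *: q i t.+1 + gamma t.+2 *: G))).
    apply: enorm_le_coord => k; have hq := dual_ge0 k (ltn0Sn t : (0 < t.+1)%N).
    have linE (u v : 'cV[R]_(m i)) c d : (c *: u + d *: v) k 0 = c * u k 0 + d * v k 0.
      by rewrite [LHS]mxE [X in X + _]mxE [X in _ + X]mxE.
    rewrite dual_step// linE [X in `|X|]mxE linE.
    have hG : 0 <= G k 0 by exact: pos_part_ge0.
    have hl : linearized i t.+1 k 0 <= G k 0.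
      by rewrite mxE; exact: pos_part_linearization.
    have p1 : 0 <= (1 - beta t.+2 * gamma t.+2) * q i t.+1 k 0.
      by rewrite mulr_ge0// subr_ge0.
    have p2 : 0 <= gamma t.+2 * G k 0 by rewrite mulr_ge0// ltW.
    have p3 := ler_wpM2l (ltW g1) hl.
    rewrite [leRHS]ger0_norm; last lra.
    rewrite ger0_norm; last by rewrite le_max lexx orbT.
    by rewrite ge_max; apply/andP; split; lra.
  rewrite (le_trans (ler_enormD _ _))// !enormZ !ger0_norm ?(ltW g1) ?subr_ge0//.
  by rewrite lerD2l ler_wpM2l// ltW.
have e0 := enorm_ge0 (q i t.+1).
have k1 : beta t.+2 * enorm (q i t.+1) <= F1.
  by apply: le_trans IH; rewrite ler_wpM2r.
have := ler_wpM2l (ltW b1) h.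
have c0 : 0 <= 1 - beta t.+2 * gamma t.+2 by rewrite subr_ge0.
have := ler_wpM2l c0 k1.
by lra.
Qed.

(** Half the squared bound on [linearized i t - beta t.+1 *: q i t]: the first two terms bound
    [linearized], the last [F1] is [dual_bound]. *)
Let G2 := (F1 + F2 * (2 * RX) + F1) ^+ 2 / 2.

(** Dropping [pos_part] only enlarges the norm. Expanding the square then gives the cross term with
    [linearized] and the damping by [beta]; divide by [2 * gamma t.+1]. *)
Lemma dual_drift i t : (0 < t)%N ->
  (2 * gamma t.+1)^-1 * (enorm (q i t.+1) ^+ 2 - enorm (q i t) ^+ 2)
    + beta t.+1 * enorm (q i t) ^+ 2
  <= gamma t.+1 * G2 + inner (q i t) (linearized i t).
Proof.
move=> t0; have g1 := gamma_gt0 (ltn0Sn t); have b1 := beta_gt0 (ltn0Sn t).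
set b := linearized i t; set qt := q i t.
have hq : enorm (q i t.+1) ^+ 2 <= enorm (qt + gamma t.+1 *: (b - beta t.+1 *: qt)) ^+ 2.
  rewrite ler_sqr ?nnegrE ?enorm_ge0// dual_step//.
  rewrite (le_trans (enorm_pos_part _))// le_eqVlt; apply/orP; left; apply/eqP.
  congr enorm; apply/colP => k; rewrite !mxE; ring.
have hd : enorm (b - beta t.+1 *: qt) ^+ 2 <= 2 * G2.
  rewrite /G2 mulrC divfK ?pnatr_eq0// ler_sqr ?nnegrE ?enorm_ge0//; last first.
    by have := A1_F1 A1; have := A1_F2 A1; have := A1_RX A1; nra.
  rewrite (le_trans (ler_enormB _ _))// lerD ?enorm_linearized//.
  rewrite enormZ ger0_norm ?(ltW b1)// (le_trans _ (dual_bound i t0))//.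
  by rewrite ler_wpM2r ?enorm_ge0// beta_antitone.
rewrite -lerBrDr ler_pdivrMl ?mulr_gt0//.
move: hq hd; rewrite !enormE.
have sqE (u v : 'cV[R]_(m i)) c : inner (u + c *: v) (u + c *: v) =
    inner u u + 2 * c * inner u v + c ^+ 2 * inner v v.
  by rewrite !(innerDl, innerDr, innerZl, innerZr) (innerC v u); ring.
rewrite sqE (innerBr b) innerZr.
have g2 : 0 <= gamma t.+1 ^+ 2 by exact: sqr_ge0.
move=> hq hd; have := ler_wpM2l g2 hd; lra.
Qed.

(** The projection step is tested against [y], with [x1 - y] split at [x0]. Towards [y], convexity
    yields the loss gap, and, as [q] is nonnegative and [y] feasible, the constraint part yields
    [pos_part (g i t x0)] against [q]. Together with the part along [x1 - x0] this makes up the term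
    in [linearized]. *)
Lemma primal_drift i t y : (0 < t)%N -> X y -> pos_part (g i t y) = 0 ->
  f i t (x i t) - f i t y + inner (q i t) (linearized i t) <=
  F2 * enorm (x i t - x i t.+1) + (2 * alpha t.+1)^-1 *
    (enorm (z i t.+1 - y) ^+ 2 - enorm (x i t.+1 - y) ^+ 2
     - enorm (x i t.+1 - z i t.+1) ^+ 2).
Proof.
move=> t0 Xy gy; have Xt := iterate_in i t0.
apply: le_trans (lerD (lexx _) (projection_step (A1_convex A1) (alg_x alg i t0) Xy
  (alpha_gt0 (ltn0Sn t)))).
rewrite (alg_omega alg)// innerDl.
set x0 := x i t in Xt *; set x1 := x i t.+1; set D := dgp i t x0.
have -> : x1 - y = (x1 - x0) - (y - x0) by rewrite opprB addrA subrK.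
rewrite 2!(innerBr (x1 - x0) (y - x0)).
have h1 := A1_df A1 i t0 Xt Xy.
have h2 : - inner (df i t x0) (x1 - x0) <= F2 * enorm (x0 - x1).
  rewrite -innerNr opprB (le_trans (cauchy_schwarz _ _))//.
  by rewrite ler_wpM2r ?enorm_ge0// (A1_df_bound A1).
have h3 : inner (D *m q i t) (y - x0) <= - inner (q i t) (pos_part (g i t x0)).
  rewrite inner_mulmx -innerNr; apply: ler_sum => k _.
  rewrite ler_wpM2l ?dual_ge0//; have := pos_part_linearization k t0 Xt Xy.
  have -> : (- pos_part (g i t x0)) k 0 = - pos_part (g i t x0) k 0 by rewrite [LHS]mxE.
  have -> : pos_part (g i t y) k 0 = 0 by rewrite gy mxE.
  by rewrite -/D; lra.
have h4 : inner (q i t) (linearized i t) =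
    inner (q i t) (pos_part (g i t x0)) + inner (D *m q i t) (x1 - x0).
  by rewrite inner_mulmx -innerDr.
by rewrite h4; move: h1 h2 h3; lra.
Qed.

Lemma displacement i t : (0 < t)%N ->
  enorm (x i t - x i t.+1) <= tau t + diam (xhat ^~ t) + enorm (x i t.+1 - z i t.+1).
Proof.
move=> t0; rewrite (le_trans (ler_enorm_dist (z i t.+1) _ _))//.
rewrite (enormBC (z i t.+1)) lerD2r (le_trans (ler_enorm_dist (xhat i t) _ _))//.
apply: lerD; first by rewrite enormBC broadcast_dist.
by rewrite mix_broadcast//; apply: (mix_diam (xhat ^~ t)); exact: WP.
Qed.

Lemma iterate_dist i j t : (0 < t)%N ->
  enorm (x i t - x j t) <= 2 * tau t + diam (xhat ^~ t).
Proof.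
move=> t0; have := broadcast_dist i t0; have := broadcast_dist j t0.
have := ler_diam (xhat ^~ t) i j; rewrite /= (enormBC (xhat i t) (x i t)).
have := ler_enorm_dist (xhat i t) (x i t) (x j t).
have := ler_enorm_dist (xhat j t) (xhat i t) (x j t).
by lra.
Qed.

(** A difference of squares: the distances differ by at most [tau t] and their sum is at most
    [4 * RX]. *)
Lemma broadcast_sqr i t y : (0 < t)%N -> X y ->
  enorm (xhat i t - y) ^+ 2 <= enorm (x i t - y) ^+ 2 + 4 * RX * tau t.
Proof.
move=> t0 Xy; have h1 := diameter (iterate_in i t0) Xy.
have h2 := diameter (broadcast_in i t0) Xy.
have := ler_enorm_dist (x i t) (xhat i t) y; have := broadcast_dist i t0.
have := enorm_ge0 (x i t - y); have := enorm_ge0 (xhat i t - y).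
have := tau_ge0 t0; have := A1_RX A1.
by move: (enorm _) (enorm _) (enorm _) h1 h2 => a b c; nra.
Qed.

Lemma sum_mix_broadcast t y : (0 < t)%N -> X y ->
  \sum_i enorm (z i t.+1 - y) ^+ 2 <=
  \sum_i enorm (x i t - y) ^+ 2 + n%:R * (4 * RX * tau t).
Proof.
move=> t0 Xy; under eq_bigr do rewrite mix_broadcast//.
rewrite (le_trans (sum_mix_sqr _ _ (WP t0)))//.
rewrite -[X in X%:R * _](card_ord n) mulr_natl -sumr_const -big_split.
by apply: ler_sum => i _; exact: broadcast_sqr.
Qed.

(** Sum over the agents of [dual_drift] and [primal_drift], whose terms in [linearized] cancel.
    Mixing costs only the threshold term, by [sum_mix_broadcast]. *)
Lemma round_bound t y : (0 < t)%N -> X y -> (forall i, pos_part (g i t y) = 0) ->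
  \sum_i (f i t (x i t) - f i t y)
  + \sum_i ((2 * gamma t.+1)^-1 * (enorm (q i t.+1) ^+ 2 - enorm (q i t) ^+ 2)
       + beta t.+1 * enorm (q i t) ^+ 2)
  + (2 * alpha t.+1)^-1 * \sum_i enorm (x i t.+1 - z i t.+1) ^+ 2 <=
  n%:R * G2 * gamma t.+1
  + F2 * (n%:R * tau t + n%:R * diam (xhat ^~ t) + \sum_i enorm (x i t.+1 - z i t.+1))
  + (2 * alpha t.+1)^-1 *
     (\sum_i enorm (x i t - y) ^+ 2 - \sum_i enorm (x i t.+1 - y) ^+ 2)
  + 2 * n%:R * RX * (tau t / alpha t.+1).
Proof.
move=> t0 Xy gy; set a := (2 * alpha t.+1)^-1.
have a0 : 0 <= a by rewrite invr_ge0 mulr_ge0// ltW// alpha_gt0.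
have nE (c : R) : n%:R * c = \sum_(i < n) c by rewrite sumr_const card_ord mulr_natl.
have -> : 2 * n%:R * RX * (tau t / alpha t.+1) = a * (n%:R * (4 * RX * tau t)).
  by rewrite /a invfM; field; rewrite gt_eqF// alpha_gt0.
have h1 := sum_mix_broadcast t0 Xy.
have h2 : \sum_i enorm (x i t - x i t.+1) <=
    n%:R * tau t + n%:R * diam (xhat ^~ t) + \sum_i enorm (x i t.+1 - z i t.+1).
  by rewrite !nE -!big_split; apply: ler_sum => i _; exact: displacement.
have h3 : \sum_i (f i t (x i t) - f i t y)
  + \sum_i ((2 * gamma t.+1)^-1 * (enorm (q i t.+1) ^+ 2 - enorm (q i t) ^+ 2)
       + beta t.+1 * enorm (q i t) ^+ 2) <=
    \sum_i (gamma t.+1 * G2 + (F2 * enorm (x i t - x i t.+1) + a *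
    (enorm (z i t.+1 - y) ^+ 2 - enorm (x i t.+1 - y) ^+ 2
     - enorm (x i t.+1 - z i t.+1) ^+ 2))).
  rewrite -big_split; apply: ler_sum => i _ /=.
  by have := dual_drift i t0; have := primal_drift t0 Xy (gy i); rewrite -/a; lra.
move: h3; rewrite !big_split /= -(nE (gamma t.+1 * G2)) -!mulr_sumr !sumrB.
have := ler_wpM2l a0 h1; have := ler_wpM2l (ltW (A1_F2 A1)) h2.
lra.
Qed.

End Run.

(** * Summation over the rounds *)

Section Abel.
Context {R : realType}.

(** Abel summation with non-decreasing weights: [h] and [h'] are potentials before and after a
    round, and [e] pays for the change of comparator. The bracket stays nonnegative, so raising its
    weight from [c T] to [c T.+1] is allowed. *)
Lemma sum_telescope_le (c h h' e : nat -> R) M T :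
  (forall s, 0 <= c s) -> (forall s, c s <= c s.+1) ->
  (forall s, 0 <= e s) -> h 0%N <= M ->
  (forall s, (s <= T)%N -> h' s <= M) ->
  (forall s, (s < T)%N -> h s.+1 - e s <= h' s) ->
  \sum_(s < T.+1) c s * (h s - h' s) <= c T * (M - h' T + \sum_(s < T) e s).
Proof.
move=> c0 cS e0 hM; elim: T => [|T IH] h'M hS.
  rewrite big_ord_recl !big_ord0 /= !addr0.
  by rewrite ler_wpM2l// lerD2r.
rewrite big_ord_recr /=.
have {}IH := IH (fun s sT => h'M s (leqW sT)) (fun s sT => hS s (leqW sT)).
rewrite (le_trans (lerD IH (lexx _)))//.
have E0 : 0 <= \sum_(s < T) e s by exact: sumr_ge0.
have m0 : 0 <= M - h' T + \sum_(s < T) e s.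
  by rewrite addr_ge0// subr_ge0 h'M.
rewrite (le_trans (lerD (ler_wpM2r m0 (cS T)) (lexx _)))//.
rewrite -mulrDr ler_wpM2l// big_ord_recr /=.
by have := hS T (leqnn _); lra.
Qed.

(** Abel summation leaves minus half the increments of [k] times [v]; since these increments are at
    most [b], half of the damping pays for them. *)
Lemma sum_drift_ge (v b k : nat -> R) T :
  (forall s, 0 <= v s) -> v 0%N = 0 -> (forall s, k s.+1 - k s <= b s) ->
  k T / 2 * v T + \sum_(s < T) b s * v s / 2 <=
  \sum_(s < T) (k s.+1 / 2 * (v s.+1 - v s) + b s * v s).
Proof.
move=> v0 vz kS; elim: T => [|T IH]; first by rewrite !big_ord0 vz mulr0 addr0.
rewrite [in leRHS]big_ord_recr [in leLHS]big_ord_recr /=.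
have := ler_wpM2r (v0 T) (kS T).
move: IH; lra.
Qed.

(** Here the Abel correction has a favourable sign, because [k] is non-decreasing and [u]
    nonnegative. *)
Lemma sum_increment_ge (u b k l : nat -> R) T :
  (forall s, 0 <= u s) -> u 0%N = 0 -> (forall s, k s <= k s.+1) ->
  (forall s, l s <= k s.+1 * (u s.+1 - u s) + b s * u s) ->
  \sum_(s < T) l s <= k T * u T + \sum_(s < T) b s * u s.
Proof.
move=> u0 uz kS lS; elim: T => [|T IH]; first by rewrite !big_ord0 uz mulr0 addr0.
rewrite ![\sum_(s < T.+1) _]big_ord_recr /=.
have := ler_wpM2r (u0 T) (kS T); have := lS T.
move: IH; lra.
Qed.

Lemma linear_le_sqr (e a : R) : 0 < a -> e <= a * e ^+ 2 / 2 + (2 * a)^-1.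
Proof.
move=> a0; rewrite -(ler_pM2l (mulr_gt0 (ltr0n _ 2) a0)) mulrDr divff; last first.
  by rewrite mulf_neq0 ?pnatr_eq0// gt_eqF.
by have := sqr_ge0 (a * e - 1); nra.
Qed.

End Abel.

(** * Energy inequality, regret and violation for the given parameters *)

Section Problem.
Context {R : realType} {n p : nat} {m : 'I_n -> nat}.
Variables (X : set 'cV[R]_p) (f : 'I_n -> nat -> 'cV[R]_p -> R)
  (g : forall i : 'I_n, nat -> 'cV[R]_p -> 'cV[R]_(m i))
  (df : 'I_n -> nat -> 'cV[R]_p -> 'cV[R]_p)
  (dg dgp : forall i : 'I_n, nat -> 'cV[R]_p -> 'M[R]_(p, m i))
  (E : nat -> rel 'I_n) (W : nat -> 'M[R]_n)
  (RX F1 F2 w : R) (B : nat)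
  (theta kappa : R) (alpha beta gamma tau : nat -> R).
Hypotheses (n_gt0 : (0 < n)%N) (mixing : mixing_of_graph E W)
  (A1 : Assumption1 X f g df dg RX F1 F2)
  (dgpP : forall (i : 'I_n) (t : nat), (0 < t)%N -> forall x : 'cV[R]_p, X x ->
    is_pos_part_subgradient (g i t x) (dg i t x) (dgp i t x))
  (A2 : Assumption2 E W w B)
  (kappa01 : 0 < kappa < 1) (theta_gt0 : 0 < theta)
  (tauE : forall t : nat, (0 < t)%N -> tau t = 1 / t%:R `^ theta)
  (alphaE : forall t : nat, (0 < t)%N ->
    alpha t = Num.sqrt ((\sum_(1 <= s < t.+1) tau s) / t%:R))
  (betaE : forall t : nat, (0 < t)%N -> beta t = 1 / t%:R `^ kappa)
  (gammaE : forall t : nat, (0 < t)%N -> gamma t = 1 / t%:R `^ (1 - kappa)).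

Local Notation run := (Algorithm1 X g df dgp W alpha beta gamma tau).
Local Notation Q := (psi_mean theta).

Let kappa_gt0 : 0 < kappa. Proof. by case/andP: kappa01. Qed.
Let kappa_lt1 : kappa < 1. Proof. by case/andP: kappa01. Qed.
Let natr_gt0 t : (0 < t)%N -> 0 < t%:R :> R. Proof. by rewrite ltr0n. Qed.
Let RX_ge0 : 0 <= RX. Proof. exact: ltW (A1_RX A1). Qed.
Let F2_ge0 : 0 <= F2. Proof. exact: ltW (A1_F2 A1). Qed.

Lemma tau_powR t : (0 < t)%N -> tau t = t%:R `^ (- theta).
Proof. by move=> t0; rewrite tauE// div1r powRN. Qed.

Lemma beta_powR t : (0 < t)%N -> beta t = t%:R `^ (- kappa).
Proof. by move=> t0; rewrite betaE// div1r powRN. Qed.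

Lemma gamma_powR t : (0 < t)%N -> gamma t = t%:R `^ (kappa - 1).
Proof. by move=> t0; rewrite gammaE// div1r -powRN opprB. Qed.

Lemma alpha_step t : (0 < t)%N -> alpha t = step theta t.
Proof.
move=> t0; rewrite alphaE// big_add1 big_mkord.
by congr (Num.sqrt (_ / _)); apply: eq_bigr => s _; rewrite tau_powR.
Qed.

Lemma tau_ge0 t : (0 < t)%N -> 0 <= tau t.
Proof. by move=> t0; rewrite tau_powR// powR_ge0. Qed.

Lemma alpha_gt0 t : (0 < t)%N -> 0 < alpha t.
Proof. by move=> t0; rewrite alpha_step// step_gt0. Qed.

Lemma beta_gt0 t : (0 < t)%N -> 0 < beta t.
Proof. by move=> t0; rewrite beta_powR// powR_gt0 ?natr_gt0. Qed.

Lemma gamma_gt0 t : (0 < t)%N -> 0 < gamma t.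
Proof. by move=> t0; rewrite gamma_powR// powR_gt0 ?natr_gt0. Qed.

(** The exponents of [beta] and [gamma] add up to 1; this relation yields both [beta_gamma] and
    [inv_gamma_increment]. *)
Lemma inv_gamma t : (0 < t)%N -> (gamma t)^-1 = t%:R * beta t.
Proof.
move=> t0; rewrite gamma_powR// beta_powR// -powRN opprB.
by rewrite powR1D// natr_gt0.
Qed.

Lemma beta_gamma t : (0 < t)%N -> beta t * gamma t <= 1.
Proof.
move=> t0; rewrite -ler_pdivlMr ?gamma_gt0// div1r inv_gamma//.
by rewrite ler_peMl ?(ltW (beta_gt0 t0))// ler1n.
Qed.

Lemma beta_antitone t : (0 < t)%N -> beta t.+1 <= beta t.
Proof. by move=> t0; rewrite !beta_powR// (threshold_antitone kappa_gt0) ?t0 ?leqnSn. Qed.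

Lemma gamma_antitone t : (0 < t)%N -> gamma t.+1 <= gamma t.
Proof.
move=> t0; rewrite !gamma_powR// -[kappa - 1]opprB threshold_antitone ?t0 ?leqnSn//.
by rewrite subr_gt0.
Qed.

Lemma inv_gamma_increment t : (0 < t)%N -> (gamma t.+1)^-1 - (gamma t)^-1 <= beta t.+1.
Proof.
move=> t0; rewrite !inv_gamma// -natr1.
by have := ler_wpM2l (ltW (natr_gt0 t0)) (beta_antitone t0); lra.
Qed.

Lemma sum_gamma T : \sum_(t < T) gamma t.+2 <= T%:R `^ kappa / kappa.
Proof.
apply: le_trans (sum_powR _ (introT andP (conj kappa_gt0 (ltW kappa_lt1)))).
by apply: ler_sum => t _; rewrite -gamma_powR// gamma_antitone.
Qed.

Lemma sum_beta T : \sum_(t < T) beta t.+2 <= T%:R `^ (1 - kappa) / (1 - kappa).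
Proof.
have k01 : 0 < 1 - kappa <= 1 by rewrite subr_gt0 kappa_lt1 gerBl ltW.
apply: le_trans (sum_powR _ k01).
apply: ler_sum => t _; rewrite addrAC subrr add0r -beta_powR//.
exact: beta_antitone.
Qed.

Lemma sum_tau T : \sum_(t < T) tau t.+1 = psi theta T.
Proof. by apply: eq_bigr => t _; rewrite tau_powR. Qed.

Lemma sum_alpha T : \sum_(t < T) alpha t.+2 <= 2 * Q T.
Proof.
apply: le_trans (sum_step theta T); apply: ler_sum => t _.
by rewrite alpha_step// step_antitone.
Qed.

Lemma sum_tau_alpha T : \sum_(t < T) tau t.+1 / alpha t.+2 <= 4 * Q T.
Proof.
apply: le_trans (sum_threshold_step theta T); apply: ler_sum => t _.
by rewrite alpha_step// tau_powR.
Qed.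

Lemma stochastic t : (0 < t)%N -> doubly_stochastic (W t).
Proof. exact: A2_stochastic A2 t. Qed.

(** The broadcast values follow the averaging recursion, perturbed by the projection displacement
    [x - z] and by the broadcast error, which is at most a threshold. *)
Lemma run_consensus : exists2 c : R, 0 <= c & forall x xhat z omega q,
  run x xhat z omega q -> forall T,
  \sum_(t < T) diam (xhat ^~ t.+1) <=
  c * (2 * RX + \sum_(t < T) \sum_i enorm (x i t.+2 - z i t.+2) + n%:R * psi theta T).
Proof.
have [c c0 cP] := consensus p mixing A2; exists c => // x xhat z omega q alg T.
have := cP (fun t i => xhat i t)
  (fun t i => (x i t.+1 - z i t.+1) + (xhat i t.+1 - x i t.+1)) (2 * RX).
move=> /(_ _ _ T) H; apply: (le_trans (H _ _)).
- move=> t i t0; rewrite -(mix_broadcast alg)//.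
  by rewrite addrA [z _ _ + _]addrC subrK addrC subrK.
- by move=> t t0; exact: (diam_broadcast A1 alg).
rewrite ler_wpM2l// -addrA lerD2l -sum_tau mulr_sumr -big_split /=.
apply: ler_sum => t _; rewrite -[X in X%:R * _](card_ord n) mulr_natl -sumr_const.
rewrite -big_split; apply: ler_sum => i _ /=.
rewrite (le_trans (ler_enormD _ _))// lerD2l.
rewrite (le_trans (broadcast_dist tau_ge0 alg _ _))//.
by rewrite !tau_powR// (threshold_antitone theta_gt0) ?leqnSn.
Qed.

Let potential (x : 'I_n -> nat -> 'cV[R]_p) t y := \sum_i enorm (x i t - y) ^+ 2.

Lemma sum_potential T x y : (0 < T)%N ->
  (forall i t, (0 < t)%N -> X (x i t)) ->
  (forall t, (0 < t <= T)%N -> X (y t)) ->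
  \sum_(t < T) (2 * alpha t.+2)^-1 * (potential x t.+1 (y t.+1) - potential x t.+2 (y t.+1)) <=
  4 * n%:R * RX * (RX + path_length y T) * Num.sqrt (T%:R / psi theta T).
Proof.
case: T => // T _ Xx Xy.
pose N := (T.+1).
(* Freezing the comparator after the last round keeps it in [X] at all positive times. *)
pose yy t := y (minn t N).
have Xyy t : (0 < t)%N -> X (yy t).
  by move=> t0; apply: Xy; rewrite /yy leq_min t0 geq_minr.
have pot_ge0 t v : 0 <= potential x t v by apply: sumr_ge0 => i _; exact: sqr_ge0.
have nE (c : R) : n%:R * c = \sum_(i < n) c by rewrite sumr_const card_ord mulr_natl.
have pot_le t v : (0 < t)%N -> X v -> potential x t v <= 4 * n%:R * RX ^+ 2.
  move=> t0 Xv; rewrite [4 * _]mulrC -mulrA nE; apply: ler_sum => i _.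
  have -> : 4 * RX ^+ 2 = (2 * RX) ^+ 2 by ring.
  rewrite ler_sqr ?nnegrE ?enorm_ge0 ?mulr_ge0//.
  by apply: (diameter A1) => //; exact: Xx.
have a0 t : 0 <= (2 * alpha t.+2)^-1 by rewrite invr_ge0 mulr_ge0// ltW// alpha_gt0.
have H := @sum_telescope_le R (fun t => (2 * alpha t.+2)^-1)
  (fun t => potential x t.+1 (yy t.+1)) (fun t => potential x t.+2 (yy t.+1))
  (fun t => 4 * n%:R * RX * enorm (yy t.+2 - yy t.+1)) (4 * n%:R * RX ^+ 2) T a0.
have {H} : \sum_(t < T.+1) (2 * alpha t.+2)^-1 *
     (potential x t.+1 (yy t.+1) - potential x t.+2 (yy t.+1)) <=
   (2 * alpha T.+2)^-1 * (4 * n%:R * RX ^+ 2 - potential x T.+2 (yy T.+1) +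
      \sum_(s < T) 4 * n%:R * RX * enorm (yy s.+2 - yy s.+1)).
  apply: H => [s|s||s _|s _].
  - rewrite lef_pV2 ?posrE ?mulr_gt0 ?alpha_gt0// ler_wpM2l//.
    by rewrite !alpha_step// step_antitone.
  - by rewrite !mulr_ge0 ?enorm_ge0.
  - by apply: pot_le => //; exact: Xyy.
  - by apply: pot_le => //; exact: Xyy.
  - rewrite lerBlDr.
    have -> : 4 * n%:R * RX * enorm (yy s.+2 - yy s.+1) =
       \sum_(i < n) 4 * RX * enorm (yy s.+2 - yy s.+1) by rewrite -nE; ring.
    rewrite -big_split; apply: ler_sum => i _ /=.
    have h1 := diameter A1 (Xx i s.+2 isT) (Xyy s.+1 isT).
    have h2 := diameter A1 (Xx i s.+2 isT) (Xyy s.+2 isT).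
    have := ler_enorm_dist (yy s.+1) (x i s.+2) (yy s.+2).
    rewrite (enormBC (yy s.+1) (yy s.+2)).
    have := enorm_ge0 (x i s.+2 - yy s.+1); have := enorm_ge0 (x i s.+2 - yy s.+2).
    have := enorm_ge0 (yy s.+2 - yy s.+1).
    by move: (enorm _) (enorm _) (enorm _) h1 h2 => a b c; nra.
have yyE t : (t < T.+1)%N -> yy t.+1 = y t.+1.
  by move=> tT; rewrite /yy (minn_idPl _).
have -> : \sum_(t < T.+1) (2 * alpha t.+2)^-1 *
     (potential x t.+1 (yy t.+1) - potential x t.+2 (yy t.+1)) =
   \sum_(t < T.+1) (2 * alpha t.+2)^-1 *
     (potential x t.+1 (y t.+1) - potential x t.+2 (y t.+1)).
  by apply: eq_bigr => t _; rewrite yyE.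
move=> /le_trans; apply.
have -> : \sum_(s < T) 4 * n%:R * RX * enorm (yy s.+2 - yy s.+1) =
    4 * n%:R * RX * path_length y T.+1.
  rewrite -mulr_sumr /path_length big_add1 big_mkord; congr (_ * _).
  by apply: eq_bigr => s _; rewrite !yyE// ltnS// ltnW.
have P0 : 0 <= path_length y T.+1 by apply: sumr_ge0 => s _; exact: enorm_ge0.
have := pot_ge0 T.+2 (yy T.+1).
have := inv_step theta (ltn0Sn T); rewrite -alpha_step// => hs hp.
apply: (@le_trans _ _ ((2 * alpha T.+2)^-1 * (4 * n%:R * RX * (RX + path_length y T.+1)))).
  by rewrite ler_wpM2l//; lra.
rewrite mulrC; apply: ler_wpM2l; first by rewrite !mulr_ge0// addr_ge0.
by rewrite invfM; lra.
Qed.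

(** The quadratic terms left over: half of the damping after [sum_drift_ge], and half of the
    projection term, the other half being spent on absorbing linear terms. *)
Definition energy (x z : 'I_n -> nat -> 'cV[R]_p) (q : forall i, nat -> 'cV[R]_(m i))
    (T : nat) : R :=
  \sum_(t < T) \sum_i beta t.+2 * enorm (q i t.+1) ^+ 2 / 2
  + \sum_i (gamma T.+1)^-1 / 2 * enorm (q i T.+1) ^+ 2
  + \sum_(t < T) (4 * alpha t.+2)^-1 * \sum_i enorm (x i t.+2 - z i t.+2) ^+ 2.

Let feasible (T : nat) (y : nat -> 'cV[R]_p) := forall t, (0 < t <= T)%N ->
  X (y t) /\ forall i, pos_part (g i t (y t)) = 0.

Let scale T (P : R) := T%:R `^ kappa + Q T + Num.sqrt (T%:R / psi theta T) * P.

(** [K] prices the disagreement: it will be [nr * F2] for the regret and 0 for the violation. The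
    constant precedes the run, the horizon and the comparator. *)
Lemma energy_bound (K : R) : 0 <= K -> exists2 C : R, 0 <= C &
  forall x xhat z omega q, run x xhat z omega q ->
  forall T y, (0 < T)%N -> feasible T y ->
  \sum_(t < T) \sum_i (f i t.+1 (x i t.+1) - f i t.+1 (y t.+1))
  + K * \sum_(t < T) diam (xhat ^~ t.+1) + energy x z q T
  <= C * scale T (path_length y T).
Proof.
move=> K0; have [c c0 cP] := run_consensus.
pose G2 : R := (F1 + F2 * (2 * RX) + F1) ^+ 2 / 2.
have G20 : 0 <= G2 by rewrite divr_ge0// sqr_ge0.
(* [K'] is the total coefficient of the disagreement. Once [run_consensus] has replaced it, [c1],
   [c2] and [c3] are the coefficients of the sum of [enorm (x - z)], of [psi] and the constant
   term. *)
pose K' : R := K + F2 * n%:R.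
have K'0 : 0 <= K' by rewrite addr_ge0// mulr_ge0.
pose c1 : R := K' * c + F2; pose c2 : R := K' * c * n%:R + F2 * n%:R.
pose c3 : R := K' * c * (2 * RX).
have c20 : 0 <= c2 by rewrite addr_ge0// !mulr_ge0.
have c30 : 0 <= c3 by rewrite !mulr_ge0.
pose nr : R := n%:R; have nr0 : 0 <= nr by rewrite ler0n.
pose C1 : R := nr * G2 / kappa.
have C10 : 0 <= C1 := divr_ge0 (mulr_ge0 nr0 G20) (ltW kappa_gt0).
(* Everything that is bounded by a multiple of [Q T]; the sum of [gamma] goes into [C1] and the
   path-length into the last term of the final constant. *)
pose C2 : R := c3 + c2 + 2 * nr * c1 ^+ 2 + 4 * nr * RX * RX + 8 * nr * RX.
have c1s : 0 <= nr * c1 ^+ 2 by rewrite mulr_ge0// sqr_ge0.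
have nX : 0 <= nr * RX by rewrite mulr_ge0.
have nXX : 0 <= nr * RX * RX by rewrite mulr_ge0.
have C20 : 0 <= C2 by rewrite /C2; lra.
exists (C1 + C2 + 4 * nr * RX).
  exact: addr_ge0 (addr_ge0 C10 C20) (mulr_ge0 (mulr_ge0 (ler0n R 4) nr0) RX_ge0).
move=> x xhat z omega q alg T y T0 feas.
set L := \sum_(t < T) \sum_i _; set D := \sum_(t < T) diam _.
pose Sr : R := \sum_(t < T) \sum_i enorm (x i t.+2 - z i t.+2).
pose Sx : R := \sum_(t < T) (4 * alpha t.+2)^-1 * \sum_i enorm (x i t.+2 - z i t.+2) ^+ 2.
pose V : R := \sum_(t < T) (2 * alpha t.+2)^-1 *
  (potential x t.+1 (y t.+1) - potential x t.+2 (y t.+1)).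
pose Bq : R := \sum_(t < T) \sum_i ((2 * gamma t.+2)^-1 *
    (enorm (q i t.+2) ^+ 2 - enorm (q i t.+1) ^+ 2) + beta t.+2 * enorm (q i t.+1) ^+ 2).
have rounds : L + Bq + 2 * Sx <=
    nr * G2 * \sum_(t < T) gamma t.+2 + F2 * (nr * psi theta T + nr * D + Sr) + V
    + 2 * nr * RX * \sum_(t < T) tau t.+1 / alpha t.+2.
  have -> : L + Bq + 2 * Sx = \sum_(t < T) (\sum_i (f i t.+1 (x i t.+1) - f i t.+1 (y t.+1))
     + \sum_i ((2 * gamma t.+2)^-1 * (enorm (q i t.+2) ^+ 2 - enorm (q i t.+1) ^+ 2)
       + beta t.+2 * enorm (q i t.+1) ^+ 2)
     + (2 * alpha t.+2)^-1 * \sum_i enorm (x i t.+2 - z i t.+2) ^+ 2).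
    rewrite !big_split /= -/L -/Bq; congr (_ + _); rewrite mulr_sumr.
    apply: eq_bigr => t _; rewrite mulrA; congr (_ * _).
    by rewrite !invfM; lra.
  have -> : nr * G2 * \sum_(t < T) gamma t.+2 + F2 * (nr * psi theta T + nr * D + Sr) + V
    + 2 * nr * RX * \sum_(t < T) tau t.+1 / alpha t.+2 =
    \sum_(t < T) (nr * G2 * gamma t.+2
     + F2 * (nr * tau t.+1 + nr * diam (xhat ^~ t.+1) + \sum_i enorm (x i t.+2 - z i t.+2))
     + (2 * alpha t.+2)^-1 * (potential x t.+1 (y t.+1) - potential x t.+2 (y t.+1))
     + 2 * nr * RX * (tau t.+1 / alpha t.+2)).
    rewrite !big_split /= -!mulr_sumr; congr (_ + F2 * _ + _ + _).
    by rewrite !big_split /= -!mulr_sumr sum_tau.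
  apply: ler_sum => t _; have [Xy gy] := feas t.+1 (ltn_ord t).
  exact: (round_bound A1 dgpP stochastic tau_ge0 alpha_gt0 beta_gt0 gamma_gt0
    beta_gamma beta_antitone alg (ltn0Sn t) Xy gy).
have hB : \sum_(t < T) \sum_i beta t.+2 * enorm (q i t.+1) ^+ 2 / 2
  + \sum_i (gamma T.+1)^-1 / 2 * enorm (q i T.+1) ^+ 2 <= Bq.
  rewrite /Bq ![\sum_(t < T) \sum_i _]exchange_big -big_split.
  apply: ler_sum => i _ /=; rewrite addrC.
  have := @sum_drift_ge R (fun s => enorm (q i s.+1) ^+ 2) (fun s => beta s.+2)
    (fun s => (gamma s.+1)^-1) T (fun s => sqr_ge0 _).
  rewrite (alg_q1 alg) enorm0 expr0n /= => /(_ erefl (fun s => inv_gamma_increment (ltn0Sn s))).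
  move=> /le_trans; apply; rewrite le_eqVlt; apply/orP; left; apply/eqP.
  by apply: eq_bigr => t _; rewrite invfM [2^-1 * _]mulrC.
(* AM-GM: a linear term [c1 * e] is at most [(4 * a)^-1 * e ^+ 2 + c1 ^+ 2 * a], which spends one of
   the two copies of [Sx] in [rounds]. *)
have hr : c1 * Sr <= Sx + nr * c1 ^+ 2 * (2 * Q T).
  apply: (@le_trans _ _ (\sum_(t < T) ((4 * alpha t.+2)^-1 *
      \sum_i enorm (x i t.+2 - z i t.+2) ^+ 2 + nr * c1 ^+ 2 * alpha t.+2))).
    rewrite /Sr mulr_sumr; apply: ler_sum => t _.
    have -> : nr * c1 ^+ 2 * alpha t.+2 = \sum_(i < n) c1 ^+ 2 * alpha t.+2.
      by rewrite sumr_const card_ord -mulr_natl mulrA.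
    rewrite !mulr_sumr -big_split; apply: ler_sum => i _ /=.
    have a0 := alpha_gt0 (ltn0Sn t.+1); move: (enorm _) (alpha _) a0 => e a a0.
    have a4 : 0 < 4 * a by lra.
    rewrite -(ler_pM2l a4).
    have -> : 4 * a * ((4 * a)^-1 * e ^+ 2 + c1 ^+ 2 * a) = e ^+ 2 + 4 * a * (c1 ^+ 2 * a).
      by rewrite mulrDr mulVKf// gt_eqF.
    by have := sqr_ge0 (e - 2 * a * c1); lra.
  rewrite big_split /= -mulr_sumr lerD2l ler_wpM2l//.
  exact: sum_alpha.
have hV : V <= 4 * nr * RX * (RX + path_length y T) * Num.sqrt (T%:R / psi theta T).
  apply: sum_potential => // [i t t0|t tT]; first exact: (iterate_in alg).
  by case: (feas t tT).
have hD : K' * D <= K' * (c * (2 * RX + Sr + nr * psi theta T)).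
  by rewrite ler_wpM2l//; exact: (cP _ _ _ _ _ alg).
have hg := ler_wpM2l (mulr_ge0 nr0 G20) (sum_gamma T).
have ht := ler_wpM2l (mulr_ge0 (mulr_ge0 (ler0n R 2) nr0) RX_ge0) (sum_tau_alpha T).
have P0 : 0 <= path_length y T by apply: sumr_ge0 => s _; exact: enorm_ge0.
pose rho : R := Num.sqrt (T%:R / psi theta T).
have rho0 : 0 <= rho by exact: sqrtr_ge0.
have rP0 : 0 <= rho * path_length y T by exact: mulr_ge0.
have rQ : rho <= Q T by exact: inv_step_le_mean.
have pQ : psi theta T <= Q T by exact: psi_le_mean.
have Q1 : 1 <= Q T by exact: psi_mean_ge1.
have Tk : 0 <= T%:R `^ kappa by exact: powR_ge0.
rewrite /energy -/Sx /scale -/rho.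
have k1 := ler_wpM2l nXX rQ.
have k2 := ler_wpM2l c20 pQ.
have k3 := ler_wpM2l c30 Q1.
have k4 : nr * G2 * (T%:R `^ kappa / kappa) = C1 * T%:R `^ kappa by rewrite /C1; ring.
have k5 : C2 * Q T = c3 * Q T + c2 * Q T + 2 * (nr * c1 ^+ 2 * Q T)
  + 4 * (nr * RX * RX * Q T) + 8 * (nr * RX * Q T) by rewrite /C2; ring.
have k6 : c1 * Sr = K' * c * Sr + F2 * Sr by rewrite /c1; ring.
have k7 : c2 * psi theta T = K' * c * nr * psi theta T + F2 * nr * psi theta T by rewrite /c2; ring.
have k8 : K' * D = K * D + F2 * nr * D by rewrite /K'; ring.
have k9 : c3 = K' * c * (2 * RX) by [].
(* Nonnegative cross terms of the product of the constant with [scale]; with them the goal is linear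
   in the remaining products. *)
have u1 := mulr_ge0 C10 (le_trans ler01 Q1).
have u2 := mulr_ge0 C10 rP0.
have u3 := mulr_ge0 C20 Tk.
have u4 := mulr_ge0 C20 rP0.
have u5 := mulr_ge0 nX Tk.
have u6 := mulr_ge0 nX (le_trans ler01 Q1).
move: rounds hB hr hV hD hg ht; rewrite -/rho k4.
clearbody C1 C2 c1 c2 c3 K' G2 nr rho L D Sr Sx V Bq.
lra.
Qed.

Lemma loss_lipschitz i t u v : (0 < t)%N -> X u -> X v ->
  f i t u <= f i t v + F2 * enorm (u - v).
Proof.
move=> t0 Xu Xv; have := A1_df A1 i t0 Xu Xv.
have : - inner (df i t u) (v - u) <= F2 * enorm (u - v).
  rewrite -innerNr opprB (le_trans (cauchy_schwarz _ _))//.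
  by rewrite ler_wpM2r ?enorm_ge0// (A1_df_bound A1).
lra.
Qed.

Lemma feasible_seqP T y : feasible_seq X g T y -> feasible T y.
Proof.
move=> h t /h[Xy gy]; split=> // i.
exact: (vec_le_mxcol (v := fun i => g i t (y t)) gy).
Qed.

Let nr : R := n%:R.
Let nr_gt0 : 0 < nr. Proof. by rewrite ltr0n. Qed.
Let nrE (c : R) : \sum_(i < n) c = nr * c.
Proof. by rewrite sumr_const card_ord mulr_natl. Qed.

Lemma path_length_ge0 (y : nat -> 'cV[R]_p) T : 0 <= path_length y T.
Proof. by apply: sumr_ge0 => s _; exact: enorm_ge0. Qed.

(** Every loss is evaluated at every agent's iterate; moving loss [j] to the iterate of agent [j]
    costs [F2] times the distance between the iterates. *)
Lemma net_reg_le x xhat z omega q T y : run x xhat z omega q ->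
  nr * net_reg f x y T <=
  \sum_(t < T) \sum_i (f i t.+1 (x i t.+1) - f i t.+1 (y t.+1))
  + nr * F2 * (2 * psi theta T + \sum_(t < T) diam (xhat ^~ t.+1)).
Proof.
move=> alg; have nr0 := lt0r_neq0 nr_gt0.
pose S1 : R := \sum_i \sum_(t < T) \sum_j f j t.+1 (x i t.+1).
pose S2 : R := \sum_(t < T) \sum_j f j t.+1 (y t.+1).
have -> : nr * net_reg f x y T = nr^-1 * S1 - S2.
  have -> : net_reg f x y T = nr^-1 * (nr^-1 * S1) - nr^-1 * S2.
    rewrite /net_reg big_add1 big_mkord -(mulr_sumr _ _ _ nr^-1); congr (_ * _ - _).
    rewrite /S1 mulr_sumr; apply: eq_bigr => i _.
    by rewrite big_add1 big_mkord mulr_sumr.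
  by rewrite mulrBr !mulVKf.
rewrite lerBlDr ler_pdivrMl// -[leRHS]nrE; apply: ler_sum => i _.
rewrite -sum_tau mulr_sumr -big_split mulr_sumr -!big_split /=.
apply: ler_sum => t _; rewrite -mulrA -nrE -!big_split; apply: ler_sum => j _ /=.
have X1 := iterate_in alg i (ltn0Sn t); have X2 := iterate_in alg j (ltn0Sn t).
have := loss_lipschitz j (ltn0Sn t) X1 X2.
have := ler_wpM2l F2_ge0 (iterate_dist tau_ge0 alg i j (ltn0Sn t)).
lra.
Qed.

(** Dropping [pos_part] in the multiplier update bounds each coordinate of [linearized] by an
    increment of [q] over [gamma] plus [beta] times [q], and [sum_increment_ge] sums this. Working
    by coordinates costs the factor [m i]. *)
Lemma violation_le x xhat z omega q i T : run x xhat z omega q ->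
  \sum_(t < T) enorm (pos_part (g i t.+1 (x i t.+1))) <=
  (m i)%:R * ((gamma T.+1)^-1 * enorm (q i T.+1)
    + \sum_(t < T) beta t.+2 * enorm (q i t.+1)
    + F2 * \sum_(t < T) enorm (x i t.+1 - x i t.+2)).
Proof.
move=> alg.
have bg_ge0 t : 0 <= beta t.+1 by exact: ltW (beta_gt0 (ltn0Sn t)).
apply: (@le_trans _ _ (\sum_(k < m i) \sum_(t < T) pos_part (g i t.+1 (x i t.+1)) k 0)).
  rewrite exchange_big; apply: ler_sum => t _ /=.
  set v := pos_part _; have v0 k : 0 <= v k 0 by exact: pos_part_ge0.
  apply: enorm_le; first by rewrite sumr_ge0.
  rewrite expr2 mulr_suml; apply: ler_sum => k _.
  by rewrite ler_wpM2l// (bigD1 k)//= lerDl sumr_ge0.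
rewrite -[X in X%:R * _](card_ord (m i)) mulr_natl -sumr_const.
apply: ler_sum => k _.
have lin t : pos_part (g i t.+1 (x i t.+1)) k 0 <=
    linearized g dgp x i t.+1 k 0 + F2 * enorm (x i t.+1 - x i t.+2).
  have [_ h] := dgp_bound A1 dgpP i (ltn0Sn t) (iterate_in alg i (ltn0Sn t)).
  have := le_trans (ler_coord_enorm _ k) (h (x i t.+2 - x i t.+1)).
  have -> : linearized g dgp x i t.+1 k 0 = pos_part (g i t.+1 (x i t.+1)) k 0
      + ((dgp i t.+1 (x i t.+1))^T *m (x i t.+2 - x i t.+1)) k 0 by rewrite [LHS]mxE.
  by rewrite enormBC ler_norml => /andP[+ _]; lra.
apply: (@le_trans _ _ (\sum_(t < T) linearized g dgp x i t.+1 k 0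
    + F2 * \sum_(t < T) enorm (x i t.+1 - x i t.+2))).
  by rewrite mulr_sumr -big_split; exact: ler_sum.
rewrite lerD2r.
have := @sum_increment_ge R (fun s => q i s.+1 k 0) (fun s => beta s.+2)
  (fun s => (gamma s.+1)^-1) (fun s => linearized g dgp x i s.+1 k 0) T
  (fun s => dual_ge0 alg k (ltn0Sn s)).
rewrite (alg_q1 alg) mxE => /(_ erefl)/(_ _ _)/le_trans; apply.
- by move=> s; rewrite lef_pV2 ?posrE ?gamma_gt0// gamma_antitone.
- move=> s; have g0 := gamma_gt0 (ltn0Sn s.+1).
  rewrite -(ler_pM2l g0) mulrDr mulVKf ?gt_eqF//.
  have := ler_pos_part ((1 - beta s.+2 * gamma s.+2) *: q i s.+1
     + gamma s.+2 *: linearized g dgp x i s.+1) k.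
  rewrite -(dual_step alg)//.
  by rewrite [X in X <= _]mxE [X in X + _]mxE [X in _ + X <= _]mxE; lra.
- rewrite lerD//.
    rewrite ler_wpM2l ?invr_ge0 ?(ltW (gamma_gt0 _))//.
    exact: le_trans (ler_norm _) (ler_coord_enorm _ _).
  apply: ler_sum => t _; rewrite ler_wpM2l//.
  exact: le_trans (ler_norm _) (ler_coord_enorm _ _).
Qed.

Lemma net_ccv_le x xhat z omega q T : run x xhat z omega q ->
  net_ccv g x T <=
  \sum_i \sum_(t < T) enorm (pos_part (g i t.+1 (x i t.+1)))
  + nr * F2 * (2 * psi theta T + \sum_(t < T) diam (xhat ^~ t.+1)).
Proof.
move=> alg; rewrite /net_ccv ler_pdivrMl//.
rewrite -[leRHS]nrE; apply: ler_sum => i _.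
rewrite big_add1 big_mkord exchange_big /=.
rewrite -sum_tau mulr_sumr -big_split mulr_sumr -big_split /=.
apply: ler_sum => t _; rewrite (le_trans (enorm_mxcol_pos_part _))//.
rewrite -mulrA -nrE -big_split; apply: ler_sum => j _ /=.
have X1 := iterate_in alg i (ltn0Sn t); have X2 := iterate_in alg j (ltn0Sn t).
rewrite (le_trans (enorm_pos_part_lipschitz A1 dgpP j (ltn0Sn t) X1 X2))//.
by rewrite lerD2l ler_wpM2l// (iterate_dist tau_ge0 alg).
Qed.

Lemma regret_bound : exists2 C : R, 0 <= C & forall x xhat z omega q,
  run x xhat z omega q -> forall T y, (0 < T)%N -> feasible_seq X g T y ->
  net_reg f x y T <= C * scale T (path_length y T).
Proof.
have nF0 : 0 <= nr * F2 by rewrite mulr_ge0// ltW.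
(* This price is the coefficient of the disagreement in [net_reg_le]; the energy itself is dropped
   as nonnegative. *)
have [C C0 CP] := energy_bound nF0.
exists (nr^-1 * (C + 2 * (nr * F2))).
  by rewrite mulr_ge0 ?invr_ge0 ?(ltW nr_gt0)// addr_ge0// mulr_ge0.
move=> x xhat z omega q alg T y T0 /feasible_seqP feas.
rewrite -mulrA ler_pdivlMl//; have h1 := net_reg_le T y alg.
have h2 := CP _ _ _ _ _ alg T y T0 feas.
have h3 : 0 <= energy x z q T.
  rewrite /energy !addr_ge0//; apply: sumr_ge0 => i _.
  - apply: sumr_ge0 => j _; rewrite divr_ge0// mulr_ge0 ?sqr_ge0//.
    exact: ltW (beta_gt0 _).
  - by rewrite mulr_ge0 ?sqr_ge0// divr_ge0// invr_ge0; exact: ltW (gamma_gt0 _).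
  - rewrite mulr_ge0 ?invr_ge0 ?mulr_ge0 ?(ltW (alpha_gt0 _))//.
    by apply: sumr_ge0 => j _; exact: sqr_ge0.
have h4 : psi theta T <= scale T (path_length y T).
  rewrite /scale; have := psi_le_mean theta_gt0 T.
  have := powR_ge0 (T%:R : R) kappa.
  have := mulr_ge0 (sqrtr_ge0 (T%:R / psi theta T)) (path_length_ge0 y T).
  lra.
have h5 := ler_wpM2l nF0 h4.
move: h1 h2 h3 h5; move: (scale _ _) (energy _ _ _ _) (\sum_(t < T) diam _) => a b d.
lra.
Qed.

Lemma violation_bound : exists2 C : R, 0 <= C & forall x xhat z omega q,
  run x xhat z omega q -> forall T y, (0 < T)%N -> feasible_static X g T y ->
  net_ccv g x T <=
  C * (T%:R `^ (1 - kappa / 2) + Num.sqrt (Q T * T%:R)).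
Proof.
have [C C0 CP] := energy_bound (lexx 0).
have [c c0 cP] := run_consensus.
have nr0 := ltW nr_gt0; have F1ge0 := ltW (A1_F1 A1).
pose C3 : R := 2 * C + nr * F1.
have C30 : 0 <= C3 by rewrite addr_ge0 ?mulr_ge0.
(* [C4], [C5] and [C6] bound, in units of [H], the sums of [enorm (x - z)], of the disagreement and
   of the displacements. [CG] and [CH] collect the multiples of [G] and of [H]. *)
pose C4 : R := C3 + 2 * nr.
pose C5 : R := c * (2 * RX + C4 + nr).
pose C6 : R := nr + nr * C5 + C4.
have C40 : 0 <= C4 by rewrite addr_ge0 ?mulr_ge0.
have C50 : 0 <= C5 by rewrite mulr_ge0// !addr_ge0// mulr_ge0.
have C60 : 0 <= C6 by rewrite !addr_ge0// mulr_ge0.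
pose N : R := (\sum_i m i)%:R.
have N0 : 0 <= N by rewrite ler0n.
pose Ck : R := nr / (1 - kappa).
have k1 : 0 < 1 - kappa by rewrite subr_gt0.
have Ck0 : 0 <= Ck by rewrite divr_ge0// ltW.
pose CG : R := N * (C3 + nr + (C3 + Ck)).
pose CH : R := N * (F2 * C6) + nr * F2 * (2 + C5).
have CG0 : 0 <= CG := mulr_ge0 N0 (addr_ge0 (addr_ge0 C30 nr0) (addr_ge0 C30 Ck0)).
have CH0 : 0 <= CH := addr_ge0 (mulr_ge0 N0 (mulr_ge0 F2_ge0 C60))
  (mulr_ge0 (mulr_ge0 nr0 F2_ge0) (addr_ge0 (ler0n R 2) C50)).
exists (CG + CH); first by rewrite addr_ge0.
move=> x xhat z omega q alg T y T0 [Xy gy].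
have feas : feasible T (fun _ => y).
  by move=> t tT; split=> // i; exact: (vec_le_mxcol (v := fun i => g i t y) (gy t tT)).
have t0 : 0 < T%:R :> R by exact: natr_gt0.
have T1 : 1 <= T%:R :> R by rewrite ler1n.
have P0 : path_length (fun _ => y) T = 0.
  by rewrite /path_length big1// => t _; rewrite subrr enorm0.
pose E1 : R := \sum_(t < T) \sum_i beta t.+2 * enorm (q i t.+1) ^+ 2 / 2.
pose E2 : R := \sum_i (gamma T.+1)^-1 / 2 * enorm (q i T.+1) ^+ 2.
pose E3 : R := \sum_(t < T) (4 * alpha t.+2)^-1 * \sum_i enorm (x i t.+2 - z i t.+2) ^+ 2.
have E10 : 0 <= E1.
  apply: sumr_ge0 => t _; apply: sumr_ge0 => i _.
  by rewrite divr_ge0// mulr_ge0 ?sqr_ge0//; exact: ltW (beta_gt0 _).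
have E20 : 0 <= E2.
  apply: sumr_ge0 => i _; rewrite mulr_ge0 ?sqr_ge0// divr_ge0// invr_ge0.
  exact: ltW (gamma_gt0 _).
have E30 : 0 <= E3.
  apply: sumr_ge0 => t _; rewrite mulr_ge0 ?invr_ge0 ?mulr_ge0 ?(ltW (alpha_gt0 _))//.
  by apply: sumr_ge0 => i _; exact: sqr_ge0.
(* A static comparator has no path-length, the scale is at most [2 * T%:R], and the loss gaps are
   bounded below by [- F1] per agent and round. *)
have EC : E1 + E2 + E3 <= C3 * T%:R.
  have := CP _ _ _ _ _ alg T _ T0 feas; rewrite P0 /scale mulr0 addr0 mul0r addr0.
  rewrite /energy -/E1 -/E2 -/E3.
  have Tk : T%:R `^ kappa <= T%:R :> R by rewrite ler1_powR// ltW.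
  have QT := psi_mean_le theta_gt0 T.
  have := ler_wpM2l C0 (lerD Tk QT).
  set L : R := \sum_(t < T) _.
  have : - (nr * F1 * T%:R) <= L.
    rewrite -mulNr -[X in _ * X%:R](card_ord T) mulr_natr -sumr_const.
    apply: ler_sum => t _; rewrite -mulrN -nrE; apply: ler_sum => i _.
    have := A1_f_bound A1 i (ltn0Sn t) (iterate_in alg i (ltn0Sn t)) Xy.
    by rewrite ler_norml => /andP[].
  by rewrite /C3; lra.
(* AM-GM weights: [lam] makes [lam * T%:R] equal to the sum-of-[beta] order over [lam], and [mu]
   makes [mu * T%:R] equal to [Q T / mu]. *)
pose lam : R := T%:R `^ (- (kappa / 2)).
have lam0 : 0 < lam by rewrite powR_gt0.
pose G : R := T%:R `^ (1 - kappa / 2).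
have G0 : 0 <= G by exact: powR_ge0.
have lamT : lam * T%:R = G by rewrite mulrC -powR1D.
have C3G : C3 * G = lam * (C3 * T%:R) by rewrite -lamT; ring.
have Tlam : T%:R `^ (1 - kappa) / lam = G.
  rewrite -powRN opprK -powRD ?(gt_eqF t0) ?implybT//.
  by congr (_ `^ _); lra.
pose H : R := Num.sqrt (Q T * T%:R).
pose mu : R := Num.sqrt (Q T / T%:R).
have Q1 : 1 <= Q T by exact: psi_mean_ge1.
have Q0 : 0 < Q T by exact: lt_le_trans Q1.
have mu0 : 0 < mu by rewrite sqrtr_gt0 divr_gt0.
have muT : mu * T%:R = H.
  rewrite -[X in _ * X](ger0_norm (ltW t0)) -sqrtr_sqr -sqrtrM; last first.
    by rewrite divr_ge0// ltW.
  by congr Num.sqrt; rewrite expr2 mulrA divfK// gt_eqF.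
have Qmu : Q T / mu = H.
  apply: (mulIf (lt0r_neq0 mu0)); rewrite divfK ?gt_eqF// /H /mu.
  rewrite -sqrtrM ?mulr_ge0 ?(ltW Q0)//.
  have -> : Q T * T%:R * (Q T / T%:R) = Q T ^+ 2.
    by rewrite mulrACA divff ?gt_eqF// mulr1 expr2.
  by rewrite sqrtr_sqr ger0_norm// ltW.
have QH : Q T <= H.
  rewrite -ler_sqr ?nnegrE ?sqrtr_ge0 ?(ltW Q0)// [leRHS]sqr_sqrtr ?mulr_ge0 ?(ltW Q0)//.
  by rewrite expr2 ler_wpM2l ?(ltW Q0)// psi_mean_le.
have H1 : 1 <= H by exact: le_trans QH.
have psiH : psi theta T <= H by exact: le_trans (psi_le_mean theta_gt0 T) QH.
have U1 : \sum_i (gamma T.+1)^-1 * enorm (q i T.+1) <= (C3 + nr) * G.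
  have g0 := gamma_gt0 (ltn0Sn T); have ig0 : 0 < (gamma T.+1)^-1 by rewrite invr_gt0.
  apply: (@le_trans _ _ (lam * E2 + nr * ((gamma T.+1)^-1 / (2 * lam)))).
    rewrite mulr_sumr -nrE -big_split; apply: ler_sum => i _ /=.
    have := ler_wpM2l (ltW ig0) (linear_le_sqr (enorm (q i T.+1)) lam0).
    lra.
  rewrite [leRHS]mulrDl; apply: lerD.
    by rewrite C3G ler_wpM2l ?(ltW lam0)//; lra.
  rewrite -Tlam ler_wpM2l// invfM mulrA ler_wpM2r ?invr_ge0 ?(ltW lam0)//.
  (* [T.+1%:R * beta T.+1] is at most twice [T%:R * beta T], and the 2 cancels the one in
     [2 * lam]. *)
  rewrite inv_gamma// powR1D// -beta_powR//.
  have bb := beta_antitone T0; have b0 := beta_gt0 T0.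
  have := ler_wpM2l (ler0n R T.+1) bb; rewrite -natr1.
  have := ler_wpM2r (ltW b0) T1; lra.
have U2 : \sum_(t < T) \sum_i beta t.+2 * enorm (q i t.+1) <= (C3 + Ck) * G.
  apply: (@le_trans _ _ (lam * E1 + nr / (2 * lam) * \sum_(t < T) beta t.+2)).
    rewrite !mulr_sumr -big_split; apply: ler_sum => t _ /=.
    rewrite -mulrA -nrE mulr_sumr -big_split; apply: ler_sum => i _ /=.
    have := ler_wpM2l (ltW (beta_gt0 (ltn0Sn t.+1))) (linear_le_sqr (enorm (q i t.+1)) lam0).
    lra.
  rewrite [leRHS]mulrDl; apply: lerD.
    by rewrite C3G ler_wpM2l ?(ltW lam0)//; lra.
  have l2 : 0 <= nr / (2 * lam) by rewrite divr_ge0 ?mulr_ge0 ?(ltW lam0).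
  apply: (le_trans (ler_wpM2l l2 (sum_beta T))).
  have -> : nr / (2 * lam) * (T%:R `^ (1 - kappa) / (1 - kappa)) =
      Ck * (T%:R `^ (1 - kappa) / lam) / 2 by rewrite /Ck invfM; ring.
  rewrite Tlam; have := mulr_ge0 Ck0 G0; lra.
have Sr : \sum_(t < T) \sum_i enorm (x i t.+2 - z i t.+2) <= C4 * H.
  apply: (@le_trans _ _ (mu * E3 + nr / mu * \sum_(t < T) alpha t.+2)).
    rewrite !mulr_sumr -big_split; apply: ler_sum => t _ /=.
    rewrite -mulrA -nrE !mulr_sumr -big_split; apply: ler_sum => i _ /=.
    have a0 := alpha_gt0 (ltn0Sn t.+1).
    (* With weight [mu / (2 * alpha t.+2)] the quadratic part is [mu] times a term of [E3] and the
       remainder is [alpha t.+2 / mu]. *)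
    have := linear_le_sqr (enorm (x i t.+2 - z i t.+2)) (divr_gt0 mu0 (mulr_gt0 (ltr0n R 2) a0)).
    rewrite !invfM !invrK; lra.
  rewrite /C4 [leRHS]mulrDl; apply: lerD.
    have -> : C3 * H = mu * (C3 * T%:R) by rewrite -muT; ring.
    by rewrite ler_wpM2l ?(ltW mu0)//; lra.
  have m2 : 0 <= nr / mu by rewrite divr_ge0// ltW.
  apply: (le_trans (ler_wpM2l m2 (sum_alpha T))).
  by rewrite -Qmu; lra.
have D : \sum_(t < T) diam (xhat ^~ t.+1) <= C5 * H.
  apply: (le_trans (cP _ _ _ _ _ alg T)); rewrite /C5 -mulrA ler_wpM2l//.
  have := ler_wpM2l nr0 psiH; have := ler_wpM2l RX_ge0 H1.
  by move: Sr; rewrite -/nr; lra.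
have Sd : \sum_(t < T) \sum_i enorm (x i t.+1 - x i t.+2) <= C6 * H.
  apply: (@le_trans _ _ (nr * psi theta T + nr * \sum_(t < T) diam (xhat ^~ t.+1)
     + \sum_(t < T) \sum_i enorm (x i t.+2 - z i t.+2))).
    rewrite -sum_tau !mulr_sumr -!big_split; apply: ler_sum => t _ /=.
    rewrite -!nrE -!big_split; apply: ler_sum => i _.
    exact: (displacement stochastic tau_ge0 alg).
  have := ler_wpM2l nr0 psiH; have := ler_wpM2l nr0 D.
  by rewrite /C6; move: Sr; lra.
apply: (le_trans (net_ccv_le T alg)).
have V : \sum_i \sum_(t < T) enorm (pos_part (g i t.+1 (x i t.+1))) <=
    N * ((C3 + nr) * G + (C3 + Ck) * G + F2 * (C6 * H)).
  apply: (@le_trans _ _ (\sum_i N * ((gamma T.+1)^-1 * enorm (q i T.+1)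
    + \sum_(t < T) beta t.+2 * enorm (q i t.+1)
    + F2 * \sum_(t < T) enorm (x i t.+1 - x i t.+2)))).
    apply: ler_sum => i _; apply: (le_trans (violation_le i T alg)).
    apply: ler_wpM2r.
      rewrite !addr_ge0 ?mulr_ge0 ?enorm_ge0 ?invr_ge0 ?(ltW (gamma_gt0 _))//.
        apply: sumr_ge0 => t _; rewrite mulr_ge0 ?enorm_ge0//.
        exact: ltW (beta_gt0 _).
      by apply: sumr_ge0 => t _; exact: enorm_ge0.
    by rewrite ler_nat (bigD1 i)//= leq_addr.
  rewrite -mulr_sumr ler_wpM2l// !big_split /=.
  apply: lerD; last by rewrite -mulr_sumr exchange_big ler_wpM2l.
  by apply: lerD => //; rewrite exchange_big.
have nF0 : 0 <= nr * F2 by rewrite mulr_ge0.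
have rest : nr * F2 * (2 * psi theta T + \sum_(t < T) diam (xhat ^~ t.+1)) <=
    nr * F2 * ((2 + C5) * H).
  by rewrite ler_wpM2l// [leRHS]mulrDl; apply: lerD => //; exact: ler_wpM2l.
apply: (le_trans (lerD V rest)).
have -> : N * ((C3 + nr) * G + (C3 + Ck) * G + F2 * (C6 * H)) + nr * F2 * ((2 + C5) * H)
    = CG * G + CH * H.
  rewrite /CH [CH * H]mulrDl mulrDr -addrA; congr (_ + _); last by rewrite -!mulrA.
  by rewrite /CG -mulrA [X in _ = N * X]mulrDl.
rewrite [leRHS]mulrDl; apply: lerD; apply: ler_wpM2l => //.
  by rewrite lerDl (le_trans ler01).
by rewrite lerDr.
Qed.

End Problem.

(** * The regret and violation rates *)

Theorem corollary1
    (R : realType) (n p : nat) (m : 'I_n -> nat) (n_gt0 : (0 < n)%N)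
    (X : set 'cV[R]_p)
    (f : 'I_n -> nat -> 'cV[R]_p -> R)
    (g : forall i : 'I_n, nat -> 'cV[R]_p -> 'cV[R]_(m i))
    (df : 'I_n -> nat -> 'cV[R]_p -> 'cV[R]_p)
    (dg dgp : forall i : 'I_n, nat -> 'cV[R]_p -> 'M[R]_(p, m i))
    (E : nat -> rel 'I_n) (W : nat -> 'M[R]_n)
    (RX F1 F2 w : R) (B : nat)
    (theta kappa : R) (alpha beta gamma tau : nat -> R)
    (feasible_nonempty : forall T : nat, (0 < T)%N ->
       exists y : nat -> 'cV[R]_p, feasible_seq X g T y)
    (static_nonempty : forall T : nat, (0 < T)%N ->
       exists y : 'cV[R]_p, feasible_static X g T y)
    (mixing : mixing_of_graph E W)
    (A1 : Assumption1 X f g df dg RX F1 F2)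
    (dgpP : forall (i : 'I_n) (t : nat), (0 < t)%N -> forall x : 'cV[R]_p, X x ->
       is_pos_part_subgradient (g i t x) (dg i t x) (dgp i t x))
    (A2 : Assumption2 E W w B)
    (A3 : Assumption3 tau)
    (kappa01 : 0 < kappa < 1) (theta_gt0 : 0 < theta)
    (tauE : forall t : nat, (0 < t)%N -> tau t = 1 / t%:R `^ theta)
    (alphaE : forall t : nat, (0 < t)%N ->
       alpha t = Num.sqrt ((\sum_(1 <= s < t.+1) tau s) / t%:R))
    (betaE : forall t : nat, (0 < t)%N -> beta t = 1 / t%:R `^ kappa)
    (gammaE : forall t : nat, (0 < t)%N -> gamma t = 1 / t%:R `^ (1 - kappa)) :
  (exists (C : R) (T0 : nat), 0 < C /\
     forall (x xhat z omega : 'I_n -> nat -> 'cV[R]_p)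
       (q : forall i : 'I_n, nat -> 'cV[R]_(m i)),
       Algorithm1 X g df dgp W alpha beta gamma tau x xhat z omega q ->
     forall T : nat, (0 < T)%N -> (T0 <= T)%N ->
     forall y : nat -> 'cV[R]_p, feasible_seq X g T y ->
       net_reg f x y T <= C * reg_rate theta kappa T (path_length y T))
  /\
  (exists (C : R) (T0 : nat), 0 < C /\
     forall (x xhat z omega : 'I_n -> nat -> 'cV[R]_p)
       (q : forall i : 'I_n, nat -> 'cV[R]_(m i)),
       Algorithm1 X g df dgp W alpha beta gamma tau x xhat z omega q ->
     forall T : nat, (0 < T)%N -> (T0 <= T)%N ->
       net_ccv g x T <= C * ccv_rate theta kappa T).
Proof.
split.
- have [c c0 cP] := regret_bound n_gt0 mixing A1 dgpP A2 kappa01 theta_gt0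
    tauE alphaE betaE gammaE.
  have [C [T0 [C0 CP]]] := reg_rate_ge theta_gt0 kappa.
  (* Adding 1 makes the constant positive, [c] being only nonnegative. *)
  exists ((c + 1) * C), T0; split; first by rewrite mulr_gt0// ltr_wpDl.
  move=> x xhat z omega q alg T T_gt0 T0T y feas.
  have P0 := path_length_ge0 y T.
  apply: (le_trans (cP _ _ _ _ _ alg T y T_gt0 feas)).
  rewrite -mulrA; apply: ler_pM; [by []| |by rewrite lerDl|exact: CP].
  by rewrite !addr_ge0 ?mulr_ge0 ?powR_ge0 ?sqrtr_ge0.
- have [c c0 cP] := violation_bound n_gt0 mixing A1 dgpP A2 kappa01 theta_gt0
    tauE alphaE betaE gammaE.
  have [C [T0 [C0 CP]]] := ccv_rate_ge theta_gt0 kappa.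
  exists ((c + 1) * C), T0; split; first by rewrite mulr_gt0// ltr_wpDl.
  move=> x xhat z omega q alg T T_gt0 T0T.
  (* The static comparator may change with [T], since the constant was fixed before it. *)
  have [y yP] := static_nonempty T T_gt0.
  apply: (le_trans (cP _ _ _ _ _ alg T y T_gt0 yP)).
  rewrite -mulrA; apply: ler_pM; [by []| |by rewrite lerDl|exact: CP].
  by rewrite addr_ge0 ?powR_ge0 ?sqrtr_ge0.
Qed.
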